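(* Let $\kappa$ be a singular cardinal with $\mathrm{cf}(\kappa)\geq\omega_1$ and $2^{\mathrm{cf}(\kappa)}<\kappa$. Suppose that for every $\alpha<\kappa$ there is an ordinal definable well-ordering of $\mathcal{P}(\alpha)$. Then there is an ordinal definable well-ordering of $\mathcal{P}(\kappa)$.
   Context: A set is ordinal definable (OD) if it is of the form $\{z\in V_\beta\mid V_\beta\models\varphi(z,\alpha_0,\dots,\alpha_{n-1})\}$ for some formula $\varphi$ of the language of set theory and ordinals $\beta,\alpha_0,\dots,\alpha_{n-1}$. *)

(* Defs.v *)
From Stdlib Require Import List.

Set Implicit Arguments.
Unset Strict Implicit.
Unset Printing Implicit Defensive.

Record structure : Type := Structure {
  carrier :> Type;
  mem : carrier -> carrier -> Prop
}.

Notation "x ∈ y" := (mem x y) (at level 70, no associativity).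

(** * First-order language of set theory *)

(* De Bruijn indices: [Fex] binds variable 0. *)
Inductive formula : Type :=
| Fmem : nat -> nat -> formula
| Feq : nat -> nat -> formula
| Fneg : formula -> formula
| Fand : formula -> formula -> formula
| Fex : formula -> formula.

Definition scons (T : Type) (x : T) (rho : nat -> T) (n : nat) : T :=
  match n with
  | 0 => x
  | S m => rho m
  end.

(* Satisfaction in the substructure of [M] with domain [D]. *)
Fixpoint sat_in (M : structure) (D : M -> Prop) (phi : formula)
    (rho : nat -> M) : Prop :=
  match phi with
  | Fmem i j => rho i ∈ rho j
  | Feq i j => rho i = rho j
  | Fneg psi => ~ sat_in D psi rho
  | Fand psi chi => sat_in D psi rho /\ sat_in D chi rho
  | Fex psi => exists x : M, D x /\ sat_in D psi (scons x rho)
  end.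

Definition sat (M : structure) (phi : formula) (rho : nat -> M) : Prop :=
  sat_in (fun _ : M => True) phi rho.

(** * ZFC *)

Definition subset (M : structure) (x y : M) : Prop :=
  forall z : M, z ∈ x -> z ∈ y.

Definition is_power (M : structure) (x p : M) : Prop :=
  forall z : M, z ∈ p <-> subset z x.

Record ZFC (M : structure) : Prop := {
  extensionality : forall x y : M, (forall z : M, z ∈ x <-> z ∈ y) -> x = y;
  foundation : forall x : M, (exists y : M, y ∈ x) ->
    exists y : M, y ∈ x /\ forall z : M, z ∈ y -> ~ z ∈ x;
  pairing : forall x y : M, exists p : M,
    forall z : M, z ∈ p <-> z = x \/ z = y;
  union : forall x : M, exists u : M,
    forall z : M, z ∈ u <-> exists y : M, y ∈ x /\ z ∈ y;
  power : forall x : M, exists p : M, is_power x p;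
  infinity : exists w : M,
    (exists e : M, e ∈ w /\ forall z : M, ~ z ∈ e) /\
    (forall x : M, x ∈ w ->
       exists s : M, s ∈ w /\ forall z : M, z ∈ s <-> z ∈ x \/ z = x);
  separation : forall (phi : formula) (rho : nat -> M) (a : M), exists b : M,
    forall z : M, z ∈ b <-> z ∈ a /\ sat phi (scons z rho);
  replacement : forall (phi : formula) (rho : nat -> M) (a : M),
    (forall x y y' : M, x ∈ a ->
       sat phi (scons x (scons y rho)) ->
       sat phi (scons x (scons y' rho)) -> y = y') ->
    exists b : M, forall y : M,
      y ∈ b <-> exists x : M, x ∈ a /\ sat phi (scons x (scons y rho));
  choice : forall a : M,
    (forall x : M, x ∈ a -> exists z : M, z ∈ x) ->
    (forall x y z : M, x ∈ a -> y ∈ a -> z ∈ x -> z ∈ y -> x = y) ->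
    exists c : M, forall x : M, x ∈ a -> exists! z : M, z ∈ x /\ z ∈ c
}.

(** * Relations and functions inside a structure *)

Definition is_upair (M : structure) (p x y : M) : Prop :=
  forall z : M, z ∈ p <-> z = x \/ z = y.

(* Kuratowski pair: [p = {{x}, {x, y}}]. *)
Definition is_opair (M : structure) (p x y : M) : Prop :=
  exists s t : M, is_upair s x x /\ is_upair t x y /\ is_upair p s t.

Definition related (M : structure) (r x y : M) : Prop :=
  exists p : M, is_opair p x y /\ p ∈ r.

Definition is_relation (M : structure) (r a b : M) : Prop :=
  forall p : M, p ∈ r -> exists x y : M, x ∈ a /\ y ∈ b /\ is_opair p x y.

Definition is_function (M : structure) (f a b : M) : Prop :=
  is_relation f a b /\ forall x : M, x ∈ a -> exists! y : M, related f x y.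

Definition is_injection (M : structure) (f a b : M) : Prop :=
  is_function f a b /\
  forall x x' y : M, related f x y -> related f x' y -> x = x'.

Definition is_bijection (M : structure) (f a b : M) : Prop :=
  is_injection f a b /\ forall y : M, y ∈ b -> exists x : M, related f x y.

(* [R] is a strict well-order of the elements of [a]. *)
Definition well_orders (M : structure) (R : M -> M -> Prop) (a : M) : Prop :=
  (forall x : M, x ∈ a -> ~ R x x) /\
  (forall x y z : M, x ∈ a -> y ∈ a -> z ∈ a -> R x y -> R y z -> R x z) /\
  (forall x y : M, x ∈ a -> y ∈ a -> R x y \/ x = y \/ R y x) /\
  (forall b : M, subset b a -> (exists x : M, x ∈ b) ->
     exists m : M, m ∈ b /\ forall x : M, x ∈ b -> m = x \/ R m x).

Definition is_well_ordering (M : structure) (r a : M) : Prop :=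
  is_relation r a a /\ well_orders (related r) a.

(** * Ordinals and cardinals *)

Definition ordinal (M : structure) (x : M) : Prop :=
  (forall y : M, y ∈ x -> subset y x) /\ well_orders (@mem M) x.

Definition ord_le (M : structure) (x y : M) : Prop := x ∈ y \/ x = y.

Definition limit_ordinal (M : structure) (x : M) : Prop :=
  ordinal x /\ (exists y : M, y ∈ x) /\
  forall y : M, y ∈ x -> exists z : M, z ∈ x /\ y ∈ z.

Definition is_omega (M : structure) (w : M) : Prop :=
  limit_ordinal w /\ forall x : M, x ∈ w -> ~ limit_ordinal x.

Definition countable (M : structure) (x : M) : Prop :=
  exists w f : M, is_omega w /\ is_injection f x w.

Definition is_omega1 (M : structure) (o : M) : Prop :=
  ordinal o /\ ~ countable o /\ forall x : M, x ∈ o -> countable x.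

Definition cardinal (M : structure) (k : M) : Prop :=
  ordinal k /\ forall x : M, x ∈ k -> ~ exists f : M, is_bijection f x k.

Definition is_cardinality (M : structure) (x k : M) : Prop :=
  cardinal k /\ exists f : M, is_bijection f x k.

(* [m = 2 ^ l], the cardinality of the power set of [l]. *)
Definition is_two_pow (M : structure) (l m : M) : Prop :=
  exists p : M, is_power l p /\ is_cardinality p m.

Definition is_cofinal_map (M : structure) (f l k : M) : Prop :=
  is_function f l k /\
  forall a : M, a ∈ k -> exists x y : M, x ∈ l /\ related f x y /\ ord_le a y.

(* [l = cf k]: the least ordinal admitting a cofinal map into [k]. *)
Definition is_cof (M : structure) (k l : M) : Prop :=
  ordinal l /\ (exists f : M, is_cofinal_map f l k) /\
  forall x : M, x ∈ l -> ~ exists f : M, is_cofinal_map f x k.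

Definition singular_cardinal (M : structure) (k : M) : Prop :=
  cardinal k /\ (exists w : M, is_omega w /\ ord_le w k) /\
  exists l : M, is_cof k l /\ l ∈ k.

(** * Ordinal definability *)

(* [v = V_b], via the recursion [V_c = \bigcup_(d < c) P(V_d)], whose
   witness [f] need only be correct on the ordinals [c <= b]. *)
Definition is_stage (M : structure) (b v : M) : Prop :=
  exists f : M,
    (forall x y y' : M, related f x y -> related f x y' -> y = y') /\
    (forall c : M, ord_le c b -> exists y : M, related f c y /\
       forall z : M, z ∈ y <->
         exists d u : M, d ∈ c /\ related f d u /\ subset z u) /\
    related f b v.

(* Variable 0 of [phi] is [z] and variables 1, ..., n are the parameters
   [alphas]; a variable beyond these is read as [z], so that [phi] is in effect
   a formula in n + 1 variables.  Satisfaction in [V_b] only makes sense for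
   parameters in [V_b], as required. *)
Definition OD (M : structure) (x : M) : Prop :=
  exists (phi : formula) (b v : M) (alphas : list M),
    ordinal b /\ is_stage b v /\
    (forall a : M, In a alphas -> ordinal a /\ a ∈ v) /\
    forall z : M, z ∈ x <->
      z ∈ v /\ sat_in (fun y => y ∈ v) phi (fun i => nth i (z :: alphas) z).

(* Main.v *)
(** Let [lambda] be the cofinality of [kappa], and call a property of points of
    [kappa] null when it fails on a club.  As [lambda] is uncountable, null sets
    form a countably complete ideal.

    Fix an ordinal definable choice of well-orderings [r_x] of the power sets
    of the [x < kappa].  A set [A] included in [kappa] is represented by
    its traces [x |-> A \cap x].  Following Shelah, rank the functions with values
    in the [(P(x), r_x)] modulo the null ideal restricted to a set [a]; countable
    completeness makes this rank well defined for non-null [a].  Let [rho] be the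
    rank of the traces of [A] on the whole of [kappa] and [J] the ideal of
    the sets on which the rank is larger than [rho].  If [A] and [B] have the
    same [rho] and [J], the points where the traces of [A] precede those of [B]
    form a set in [J], and vice versa; so the traces agree on a non-null, hence
    unbounded, set, and [A = B].

    A cofinal map from [lambda] to [kappa] turns [J] into a subset of [P(lambda)].
    Two cofinal maps agree on a club, so this subset does not depend on the map,
    which need not be ordinal definable.  As [2 ^ lambda < kappa], the order type
    of [r_lambda] is some [theta < kappa], whence [r_theta] well-orders these
    subsets, and [P(kappa)] is ordered lexicographically by [rho] and [J].

    A definable choice of the [r_x] requires a definable enumeration of
    the ordinal definable sets, although the formulas in the definition of [OD] are
    external.  It is obtained by closing the basic relations on assignments
    [omega -> V_b] under the logical operations, by a transfinite recursion which
    at each step adds the first set not obtained so far. *)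

From Stdlib Require Import List Arith Lia ssreflect.
From Stdlib Require Import Classical ClassicalEpsilon FunctionalExtensionality PropExtensionality.
Require Import Defs.

Set Implicit Arguments.
Unset Strict Implicit.
Unset Printing Implicit Defensive.

(** * Definability with parameters *)

Lemma scons_eta (T : Type) (e : nat -> T) : scons (e 0) (fun n => e (S n)) = e.
Proof. by apply: functional_extensionality => -[]. Qed.

Fixpoint app_env (T : Type) (l : list T) (e : nat -> T) : nat -> T :=
  match l with
  | nil => e
  | x :: l' => scons x (app_env l' e)
  end.

Lemma app_env_nth (T : Type) (l : list T) (e : nat -> T) n d :
  n < length l -> app_env l e n = nth n l d.
Proof.
elim: l n => [|x l IH] [|n] //=; [lia | lia | move=> h; apply: IH; lia].
Qed.

Lemma app_env_shift (T : Type) (l : list T) (e : nat -> T) n :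
  app_env l e (length l + n) = e n.
Proof. by elim: l => //= x l ->. Qed.

Lemma app_env_at (T : Type) (l : list T) (e : nat -> T) :
  app_env l e (length l) = e 0.
Proof. by rewrite -(app_env_shift l e 0) Nat.add_0_r. Qed.

Lemma app_env_app (T : Type) (l l' : list T) (e : nat -> T) :
  app_env (l ++ l') e = app_env l (app_env l' e).
Proof. by elim: l => //= x l ->. Qed.

Definition up_ren (r : nat -> nat) (n : nat) : nat :=
  match n with 0 => 0 | S m => S (r m) end.

Fixpoint ren (r : nat -> nat) (phi : formula) : formula :=
  match phi with
  | Fmem i j => Fmem (r i) (r j)
  | Feq i j => Feq (r i) (r j)
  | Fneg p => Fneg (ren r p)
  | Fand p q => Fand (ren r p) (ren r q)
  | Fex p => Fex (ren (up_ren r) p)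
  end.

Lemma sat_in_ren (M : structure) (X : M -> Prop) phi r rho :
  sat_in X (ren r phi) rho <-> sat_in X phi (fun n => rho (r n)).
Proof.
elim: phi r rho => [i j|i j|p IH|p IHp q IHq|p IH] r rho //=.
- by rewrite IH.
- by rewrite IHp IHq.
- have E x : scons x (fun n => rho (r n)) = (fun n => scons x rho (up_ren r n)).
    by apply: functional_extensionality => -[].
  by split=> -[x [hx]]; [move/IH | rewrite E => h]; exists x; split=> //;
     [rewrite E | apply/IH].
Qed.

Section Definability.
Variables (M : structure) (C : M -> Prop).
Implicit Types (P Q : (nat -> M) -> Prop) (t s : (nat -> M) -> M).

(* [P] is first-order definable from parameters in [C]; a term is definable
   when its graph is. *)
Definition dfn P : Prop := exists phi l, Forall C l /\
  forall e, sat phi (app_env l e) <-> P e.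

Definition dt t : Prop := dfn (fun e => e 0 = t (fun n => e (S n))).

Lemma dfn_ext P Q : dfn P -> (forall e, P e <-> Q e) -> dfn Q.
Proof. by move=> [phi [l [hl h]]] hPQ; exists phi, l; split=> // e; rewrite h. Qed.

Lemma dfn_ren P (r : nat -> nat) : dfn P -> dfn (fun e => P (fun n => e (r n))).
Proof.
move=> [phi [l [hl h]]].
(* The parameters occupy the first [length l] slots, so only the indices beyond them are renamed. *)
exists (ren (fun n => if n <? length l then n else length l + r (n - length l)) phi), l.
split=> // e; rewrite -h /sat sat_in_ren.
suff -> : (fun n => app_env l e (if n <? length l then n else length l + r (n - length l)))
        = app_env l (fun n => e (r n)) by [].
apply: functional_extensionality => n; case: Nat.ltb_spec => hn.
  by rewrite !(app_env_nth _ (e 0)).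
rewrite app_env_shift; have -> : n = length l + (n - length l) by lia.
by rewrite app_env_shift; congr (e (r _)); lia.
Qed.

Lemma dfn_not P : dfn P -> dfn (fun e => ~ P e).
Proof.
by move=> [phi [l [hl h]]]; exists (Fneg phi), l; split=> // e /=; rewrite -h.
Qed.

Lemma dfn_and P Q : dfn P -> dfn Q -> dfn (fun e => P e /\ Q e).
Proof.
move=> [phi [l [hl h]]] [psi [l' [hl' h']]].
exists (Fand (ren (fun n => if n <? length l then n else length l' + n) phi)
             (ren (fun n => length l + n) psi)), (l ++ l').
split=> [|e]; first by apply/Forall_app.
rewrite /sat /= !sat_in_ren -h -h' /sat.
have E1 : (fun n => app_env (l ++ l') e (if n <? length l then n else length l' + n))
        = app_env l e.
  apply: functional_extensionality => n; rewrite app_env_app; case: Nat.ltb_spec => hn.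
    by rewrite !(app_env_nth _ (e 0)).
  have -> : length l' + n = length l + (length l' + (n - length l)) by lia.
  rewrite !app_env_shift; have -> : n = length l + (n - length l) by lia.
  by rewrite app_env_shift; congr e; lia.
have E2 : (fun n => app_env (l ++ l') e (length l + n)) = app_env l' e.
  by apply: functional_extensionality => n; rewrite app_env_app app_env_shift.
by rewrite E1 E2.
Qed.

(** [Fex] binds variable 0, while the quantified variable of [P] sits just after the parameters; the
    renaming moves slot [length l] to the front. *)
Lemma dfn_ex (P : M -> (nat -> M) -> Prop) :
  dfn (fun e => P (e 0) (fun n => e (S n))) -> dfn (fun e => exists x, P x e).
Proof.
move=> [phi [l [hl h]]].
exists (Fex (ren (fun n => if n <? length l then S n else
   if n =? length l then 0 else n) phi)), l.
split=> // e; rewrite /sat /=.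
have E x : (fun n => scons x (app_env l e) (if n <? length l then S n else
   if n =? length l then 0 else n)) = app_env l (scons x e).
  apply: functional_extensionality => n; case: Nat.ltb_spec => hn.
    by rewrite /= !(app_env_nth _ (e 0)).
  case: Nat.eqb_spec => [->|hn'].
    by rewrite app_env_at.
  have -> : n = length l + S (n - length l - 1) by lia.
  by rewrite app_env_shift Nat.add_succ_r /= app_env_shift.
split=> [[x [_]]|[x hx]].
  by rewrite sat_in_ren E => /h /= hx; exists x.
by exists x; split=> //; rewrite sat_in_ren E; apply/h.
Qed.

Lemma dfn_mem_var i j : dfn (fun e => e i ∈ e j).
Proof. by exists (Fmem i j), nil. Qed.

Lemma dfn_eq_var i j : dfn (fun e => e i = e j).
Proof. by exists (Feq i j), nil. Qed.

Lemma dt_var i : dt (fun e => e i).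
Proof. exact: dfn_eq_var. Qed.

Lemma dt_const c : C c -> dt (fun _ => c).
Proof.
move=> hc; exists (Feq 1 0), (c :: nil); split; first by repeat constructor.
by move=> e.
Qed.

Lemma dt_ren t (r : nat -> nat) : dt t -> dt (fun e => t (fun n => e (r n))).
Proof. by move=> h; apply: (dfn_ren (up_ren r) h). Qed.

(** A term is only known through its graph, so substitution goes through an existential quantifier
    over its value. *)
Lemma dfn_let P t : dfn P -> dt t -> dfn (fun e => P (scons (t e) e)).
Proof.
move=> hP ht; apply: (@dfn_ext (fun e => exists x, x = t e /\ P (scons x e))).
  apply: dfn_ex; apply: dfn_and => //.
  by apply: dfn_ext hP _ => e; rewrite scons_eta.
by move=> e; split=> [[x [-> ]]|h] //; exists (t e).
Qed.

(** This and the next lemmas reduce the definability of a notion at arbitrary terms to its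
    definability at variables, so that each notion is unfolded only once. *)
Lemma dfn1 (Q : M -> Prop) t : dfn (fun e => Q (e 0)) -> dt t -> dfn (fun e => Q (t e)).
Proof. by move=> h ht; apply: dfn_let h ht. Qed.

Lemma dfn2 (Q : M -> M -> Prop) t s :
  dfn (fun e => Q (e 0) (e 1)) -> dt t -> dt s -> dfn (fun e => Q (t e) (s e)).
Proof.
move=> h ht hs.
exact: (dfn_let (dfn_let h (dt_ren (fun n => S n) ht)) hs).
Qed.

Lemma dfn3 (Q : M -> M -> M -> Prop) t s u :
  dfn (fun e => Q (e 0) (e 1) (e 2)) -> dt t -> dt s -> dt u ->
  dfn (fun e => Q (t e) (s e) (u e)).
Proof.
move=> h ht hs hu.
exact: (dfn_let (dfn_let (dfn_let h (dt_ren (fun n => S (S n)) ht))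
                         (dt_ren (fun n => S n) hs)) hu).
Qed.

Lemma dfn4 (Q : M -> M -> M -> M -> Prop) t s u v :
  dfn (fun e => Q (e 0) (e 1) (e 2) (e 3)) -> dt t -> dt s -> dt u -> dt v ->
  dfn (fun e => Q (t e) (s e) (u e) (v e)).
Proof.
move=> h ht hs hu hv.
exact: (dfn_let (dfn_let (dfn_let (dfn_let h (dt_ren (fun n => S (S (S n))) ht))
                 (dt_ren (fun n => S (S n)) hs)) (dt_ren (fun n => S n) hu)) hv).
Qed.

Lemma dt1 (F : M -> M) t : dt (fun e => F (e 0)) -> dt t -> dt (fun e => F (t e)).
Proof.
move=> h ht.
exact: (@dfn2 (fun a b => a = F b) _ _ h (dt_var 0) (dt_ren (fun n => S n) ht)).
Qed.

Lemma dt2 (F : M -> M -> M) t s :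
  dt (fun e => F (e 0) (e 1)) -> dt t -> dt s -> dt (fun e => F (t e) (s e)).
Proof.
move=> h ht hs.
exact: (@dfn3 (fun a b c => a = F b c) _ _ _ h (dt_var 0) (dt_ren (fun n => S n) ht)
       (dt_ren (fun n => S n) hs)).
Qed.

Lemma dt3 (F : M -> M -> M -> M) t s u :
  dt (fun e => F (e 0) (e 1) (e 2)) -> dt t -> dt s -> dt u ->
  dt (fun e => F (t e) (s e) (u e)).
Proof.
move=> h ht hs hu.
exact: (@dfn4 (fun a b c d => a = F b c d) _ _ _ _ h (dt_var 0) (dt_ren (fun n => S n) ht)
       (dt_ren (fun n => S n) hs) (dt_ren (fun n => S n) hu)).
Qed.

Lemma dfn_mem t s : dt t -> dt s -> dfn (fun e => t e ∈ s e).
Proof. by apply: (dfn2 (Q := @mem M)); apply: dfn_mem_var. Qed.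

Lemma dfn_eq t s : dt t -> dt s -> dfn (fun e => t e = s e).
Proof. by apply: (dfn2 (Q := @eq M)); apply: dfn_eq_var. Qed.

Lemma dfn_or P Q : dfn P -> dfn Q -> dfn (fun e => P e \/ Q e).
Proof.
move=> hP hQ; apply: dfn_ext (dfn_not (dfn_and (dfn_not hP) (dfn_not hQ))) _ => e.
by split=> [h|]; [apply: NNPP | ]; tauto.
Qed.

Lemma dfn_imp P Q : dfn P -> dfn Q -> dfn (fun e => P e -> Q e).
Proof.
move=> hP hQ; apply: dfn_ext (dfn_or (dfn_not hP) hQ) _ => e.
by case: (classic (P e)); tauto.
Qed.

Lemma dfn_iff P Q : dfn P -> dfn Q -> dfn (fun e => P e <-> Q e).
Proof. by move=> hP hQ; apply: dfn_and; apply: dfn_imp. Qed.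

Lemma dfn_all (P : M -> (nat -> M) -> Prop) :
  dfn (fun e => P (e 0) (fun n => e (S n))) -> dfn (fun e => forall x, P x e).
Proof.
move=> h; apply: dfn_ext (dfn_not (dfn_ex (P := fun x e => ~ P x e) (dfn_not h))) _ => e.
split=> [h' x|h' [x hx]]; last exact: hx.
by apply: NNPP => hx; apply: h'; exists x.
Qed.

Lemma dfn_true : dfn (fun _ => True).
Proof. by apply: dfn_ext (dfn_eq_var 0 0) _. Qed.

Lemma dfn_false : dfn (fun _ => False).
Proof. by apply: dfn_ext (dfn_not dfn_true) _ => e; tauto. Qed.

(** The formula is fixed outside the model, so induction on it suffices and no truth predicate is
    involved. *)
Lemma dfn_sat phi (t : nat -> (nat -> M) -> M) :
  (forall i, dt (t i)) -> dfn (fun e => sat phi (fun i => t i e)).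
Proof.
elim: phi t => [i j|i j|p IH|p IHp q IHq|p IH] t ht.
- by apply: dfn_mem.
- by apply: dfn_eq.
- by apply: dfn_not; apply: IH.
- by apply: dfn_and; [apply: IHp | apply: IHq].
- apply: (dfn_ex (P := fun x e => _ /\ sat p (scons x (fun i => t i e)))).
  apply: dfn_and; first exact: dfn_true.
  apply: dfn_ext (IH (fun i => match i with 0 => fun e => e 0
                     | S j => fun e => t j (fun n => e (S n)) end) _) _.
    by move=> [|i]; [apply: dt_var | apply: dt_ren].
  move=> e; suff -> : (fun i => match i with 0 => fun e => e 0
     | S j => fun e => t j (fun n => e (S n)) end e) =
     scons (e 0) (fun i => t i (fun n => e (S n))) by [].
  by apply: functional_extensionality => -[].
Qed.

End Definability.

(** Two classes of parameters matter: arbitrary ones, as separation and replacement allow, and the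
    ordinals, as ordinal definability demands. *)
Definition any (M : structure) (x : M) : Prop := True.

Lemma any_i (M : structure) (x : M) : any x.
Proof. by []. Qed.


(* Proof search for definability *)
Create HintDb def.
#[export] Hint Constants Opaque : def.
#[export] Hint Variables Opaque : def.
#[export] Hint Resolve any_i dt_var dfn_mem dfn_eq dfn_not dfn_and dfn_or
  dfn_imp dfn_iff dfn_true dfn_false : def.
#[export] Hint Extern 20 (dt _ (fun _ => _)) => simple apply dt_const : def.
#[export] Hint Extern 1 (dfn _ (fun _ => exists _, _)) => simple apply dfn_ex; cbv beta : def.
#[export] Hint Extern 1 (dfn _ (fun _ => forall _, _)) => simple apply dfn_all; cbv beta : def.

Ltac def := cbv beta; auto 60 with def nocore.

(** * Comprehension and definite description as total operators *)

Record zfc : Type := Zfc { zfc_structure :> structure; zfc_axioms : ZFC zfc_structure }.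

Section SetBuilder.
Variable M : zfc.
Implicit Types (x y z a b : M) (P Q : M -> Prop).

Lemma set_ext x y : (forall z, z ∈ x <-> z ∈ y) -> x = y.
Proof. exact: (extensionality (zfc_axioms M)). Qed.

Lemma zfc_inhabited : inhabited M.
Proof. by have [w _] := infinity (zfc_axioms M); constructor. Qed.

Lemma separate P a : dfn (@any M) (fun e => P (e 0)) ->
  exists b, forall z, z ∈ b <-> z ∈ a /\ P z.
Proof.
move=> [phi [l [_ h]]].
(* All variables past the parameters are sent to [z], which matches the constant environment
   [fun _ => z]. *)
have [b hb] := separation (zfc_axioms M)
  (ren (fun n => if n <? length l then S n else 0) phi) (app_env l (fun _ => a)) a.
exists b => z; rewrite hb /sat sat_in_ren.
suff -> : (fun n => scons z (app_env l (fun _ => a)) (if n <? length l then S n else 0))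
   = app_env l (fun _ => z) by rewrite -(h (fun _ => z)).
apply: functional_extensionality => n; case: Nat.ltb_spec => hn /=.
  by rewrite !(app_env_nth _ a).
have -> : n = length l + (n - length l) by lia.
by rewrite app_env_shift.
Qed.

Lemma replace (R : M -> M -> Prop) a : dfn (@any M) (fun e => R (e 0) (e 1)) ->
  (forall x y y', x ∈ a -> R x y -> R x y' -> y = y') ->
  exists b, forall y, y ∈ b <-> exists x, x ∈ a /\ R x y.
Proof.
move=> [phi [l [_ h]]] hf.
(* The slot right after the parameters is [x], and all later ones are [y]. *)
pose r n := if n <? length l then S (S n) else if n =? length l then 0 else 1.
have E x y : sat (ren r phi) (scons x (scons y (app_env l (fun _ => a)))) <-> R x y.
  rewrite /sat sat_in_ren.
  suff -> : (fun n => scons x (scons y (app_env l (fun _ => a))) (r n))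
    = app_env l (scons x (fun _ => y)) by rewrite -(h (scons x (fun _ => y))).
  apply: functional_extensionality => n; rewrite /r; case: Nat.ltb_spec => hn /=.
    by rewrite !(app_env_nth _ a).
  case: Nat.eqb_spec => [->|hn'] /=.
    by rewrite app_env_at.
  have -> : n = length l + S (n - length l - 1) by lia.
  by rewrite app_env_shift.
have [|b hb] := @replacement _ (zfc_axioms M) (ren r phi) (app_env l (fun _ => a)) a.
  by move=> x y y' hx /E h1 /E h2; apply: hf h1 h2.
exists b => y; rewrite hb; split=> -[x [hx /E hxy]]; by exists x.
Qed.

Lemma empty_exists : exists x, forall z, ~ z ∈ x.
Proof. by have [w [[e [_ he]] _]] := infinity (zfc_axioms M); exists e. Qed.

Definition small P : Prop := exists b, forall z, z ∈ b <-> P z.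

(** The operator is picked outside the model, but extensionality forces its value at every [P], so
    the choice introduces nothing undefinable. *)
Lemma comprehension : {c : (M -> Prop) -> M | forall P,
  (forall z, z ∈ c P <-> P z) \/ (~ small P /\ forall z, ~ z ∈ c P)}.
Proof.
apply: constructive_indefinite_description.
exists (fun P => epsilon zfc_inhabited
  (fun b => (forall z, z ∈ b <-> P z) \/ (~ small P /\ forall z, ~ z ∈ b))) => P.
apply: (@epsilon_spec _ zfc_inhabited (fun b => (forall z, z ∈ b <-> P z)
  \/ (~ small P /\ forall z, ~ z ∈ b))).
case: (classic (small P)) => [[b hb]|h]; first by exists b; left.
by have [e he] := empty_exists; exists e; right.
Qed.

(* The set [{z | P z}], and the empty set when this is a proper class. *)
Definition cpr : (M -> Prop) -> M := proj1_sig comprehension.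

Lemma cpr_spec P : (forall z, z ∈ cpr P <-> P z) \/ (~ small P /\ forall z, ~ z ∈ cpr P).
Proof. exact: (proj2_sig comprehension). Qed.

Lemma in_cpr P : small P -> forall z, z ∈ cpr P <-> P z.
Proof. by move=> h; case: (cpr_spec P) => [|[]]. Qed.

Lemma cpr_ext P Q : (forall z, P z <-> Q z) -> cpr P = cpr Q.
Proof.
move=> h; congr cpr; apply: functional_extensionality => z.
exact: propositional_extensionality.
Qed.

(** Since the junk value is fixed to be the empty set, the graph of [cpr] is first-order; [dt_cpr]
    rests on this. *)
Lemma cprE P x : x = cpr P <->
  (forall z, z ∈ x <-> P z) \/ (~ small P /\ forall z, ~ z ∈ x).
Proof.
split=> [->|]; first exact: cpr_spec.
case=> [h|[h1 h2]]; apply: set_ext => z.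
  by rewrite h; rewrite in_cpr //; exists x.
case: (cpr_spec P) => [h3|[_ h3]]; first by case: h1; exists (cpr P).
by split=> h; [case: (h2 z)| case: (h3 z)].
Qed.

Lemma dfn_small C (P : M -> (nat -> M) -> Prop) :
  dfn C (fun e => P (e 0) (fun n => e (S n))) -> dfn C (fun e => small (fun z => P z e)).
Proof.
move=> h; apply: (dfn_ex (P := fun b e => forall z, z ∈ b <-> P z e)).
apply: (dfn_all (P := fun z e => z ∈ e 0 <-> P z (fun n => e (S n)))).
apply: dfn_iff; first by def.
exact: (dfn_ren (up_ren S) h).
Qed.

Lemma dt_cpr C (P : M -> (nat -> M) -> Prop) :
  dfn C (fun e => P (e 0) (fun n => e (S n))) -> dt C (fun e => cpr (fun z => P z e)).
Proof.
move=> h.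
have hS : dfn C (fun e => P (e 0) (fun n => e (S (S n)))).
  exact: (dfn_ren (up_ren S) h).
apply: dfn_ext (fun e => iff_sym (@cprE _ _)).
apply: dfn_or.
  by apply: (dfn_all (P := fun z e => z ∈ e 0 <-> P z (fun n => e (S n)))); apply: dfn_iff; def.
apply: dfn_and; last by def.
apply: dfn_not; exact: (dfn_small (P := fun z e => P z (fun n => e (S n)))).
Qed.

Lemma small_sub P a : dfn (@any M) (fun e => P (e 0)) -> (forall z, P z -> z ∈ a) -> small P.
Proof.
move=> h hP; have [b hb] := separate a h; exists b => z; rewrite hb.
by split=> [[]|hz] //; split=> //; apply: hP.
Qed.

Lemma small_image (R : M -> M -> Prop) a : dfn (@any M) (fun e => R (e 0) (e 1)) ->
  (forall x y y', x ∈ a -> R x y -> R x y' -> y = y') ->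
  small (fun y => exists x, x ∈ a /\ R x y).
Proof. exact: replace. Qed.

(* The unique [x] with [P x], and a fixed junk set when there is none. *)
Definition the P : M := cpr (fun z => exists x, P x /\ (forall y, P y -> y = x) /\ z ∈ x).

Lemma the_eq P x : P x -> (forall y, P y -> y = x) -> the P = x.
Proof.
move=> hx hu; symmetry; apply/cprE; left=> z; split=> [hz|[y [hy [_ hz]]]]; first by exists x.
by rewrite -(hu y).
Qed.

Lemma the_spec P : (exists x, P x) -> (forall x y, P x -> P y -> x = y) -> P (the P).
Proof.
by move=> [x hx] hu; rewrite (@the_eq P x) // => y hy; apply: hu.
Qed.

Lemma dt_the C (P : M -> (nat -> M) -> Prop) :
  dfn C (fun e => P (e 0) (fun n => e (S n))) -> dt C (fun e => the (fun z => P z e)).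
Proof.
move=> h.
have hS : dfn C (fun e => P (e 0) (fun n => e (S (S n)))) := dfn_ren (up_ren S) h.
have hS2 : dfn C (fun e => P (e 0) (fun n => e (S (S (S n))))) :=
  dfn_ren (up_ren (fun n => S (S n))) h.
apply: (dt_cpr (P := fun z e => exists x, P x e /\ (forall y, P y e -> y = x) /\ z ∈ x)).
by def.
Qed.

End SetBuilder.

#[export] Hint Extern 1 (dt _ (fun _ => cpr _)) => simple apply dt_cpr; cbv beta : def.
#[export] Hint Extern 1 (dt _ (fun _ => the _)) => simple apply dt_the; cbv beta : def.
#[export] Hint Extern 1 (dfn _ (fun _ => small _)) => simple apply dfn_small; cbv beta : def.

(** * Basic set operations *)

Section Operations.
Variable M : zfc.
Implicit Types (x y z a b f p : M).

Definition emp : M := cpr (fun _ => False).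
Definition pw x : M := cpr (fun z => subset z x).
Definition Un x : M := cpr (fun z => exists y, y ∈ x /\ z ∈ y).
Definition upr x y : M := cpr (fun z => z = x \/ z = y).
Definition op x y : M := upr (upr x x) (upr x y).
Definition cup x y : M := Un (upr x y).
Definition succ x : M := cup x (upr x x).
Definition ite (P : Prop) x y : M := cpr (fun z => P /\ z ∈ x \/ ~ P /\ z ∈ y).
Definition ap f x : M := the (fun y => op x y ∈ f).
Definition lam a (F : M -> M) : M := cpr (fun p => exists x, x ∈ a /\ p = op x (F x)).
Definition prod a b : M := cpr (fun p => exists x y, x ∈ a /\ y ∈ b /\ p = op x y).
(** The equation [f = lam a (ap f)] says that [f] consists of exactly one pair for each point of [a]
    and of nothing else. *)
Definition Funs a b : M := cpr (fun f => f = lam a (ap f) /\ forall x, x ∈ a -> ap f x ∈ b).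

Lemma dfn_subset C t s : dt C t -> dt C s -> dfn C (fun e => subset (t e : M) (s e)).
Proof. by apply: (dfn2 (Q := @subset M)); rewrite /subset; def. Qed.
#[local] Hint Resolve dfn_subset : def.

Lemma dt_emp C : dt C (fun _ => emp).
Proof. by rewrite /emp; def. Qed.
Lemma dt_pw C t : dt C t -> dt C (fun e => pw (t e)).
Proof. by apply: dt1; rewrite /pw; def. Qed.
Lemma dt_Un C t : dt C t -> dt C (fun e => Un (t e)).
Proof. by apply: dt1; rewrite /Un; def. Qed.
Lemma dt_upr C t s : dt C t -> dt C s -> dt C (fun e => upr (t e) (s e)).
Proof. by apply: dt2; rewrite /upr; def. Qed.
#[local] Hint Resolve dt_emp dt_pw dt_Un dt_upr : def.
Lemma dt_op C t s : dt C t -> dt C s -> dt C (fun e => op (t e) (s e)).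
Proof. by apply: dt2; rewrite /op; def. Qed.
Lemma dt_cup C t s : dt C t -> dt C s -> dt C (fun e => cup (t e) (s e)).
Proof. by apply: dt2; rewrite /cup; def. Qed.
#[local] Hint Resolve dt_op dt_cup : def.
Lemma dt_succ C t : dt C t -> dt C (fun e => succ (t e)).
Proof. by apply: dt1; rewrite /succ; def. Qed.
Lemma dt_ap C t s : dt C t -> dt C s -> dt C (fun e => ap (t e) (s e)).
Proof. by apply: dt2; rewrite /ap; def. Qed.
#[local] Hint Resolve dt_succ dt_ap : def.

Lemma dt_lam C t (F : M -> (nat -> M) -> M) : dt C t ->
  dt C (fun e => F (e 0) (fun n => e (S n))) -> dt C (fun e => lam (t e) (fun x => F x e)).
Proof.
move=> ht hF; rewrite /lam.
apply: (dt_cpr (P := fun p e => exists x, x ∈ t e /\ p = op x (F x e))).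
apply: (dfn_ex (P := fun x e => x ∈ t (fun n => e (S n)) /\ e 0 = op x (F x (fun n => e (S n))))).
have ht2 := dt_ren (fun n => S (S n)) ht.
have hF2 := dt_ren (up_ren S) hF.
by apply: dfn_and; [|apply: dfn_eq; [|apply: dt_op]]; def.
Qed.

Lemma dt_ite C P t s : dfn C P -> dt C t -> dt C s ->
  dt C (fun e => ite (P e) (t e) (s e)).
Proof.
move=> hP ht hs; rewrite /ite.
apply: (dt_cpr (P := fun z e => P e /\ z ∈ t e \/ ~ P e /\ z ∈ s e)).
have ht' := dt_ren S ht; have hs' := dt_ren S hs; have hP' := dfn_ren S hP.
by def.
Qed.
End Operations.

#[export] Hint Resolve dfn_subset dt_emp dt_pw dt_Un dt_upr dt_op dt_cup dt_succ dt_ap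
  dt_ite : def.
#[export] Hint Extern 1 (dt _ (fun _ => lam _ _)) => simple apply dt_lam; cbv beta : def.

Arguments emp {M}.

Section OperationsDt.
Variable M : zfc.

Lemma dt_prod C (t s : (nat -> M) -> M) : dt C t -> dt C s -> dt C (fun e => prod (t e) (s e)).
Proof. by apply: dt2; rewrite /prod; def. Qed.
Lemma dt_Funs C (t s : (nat -> M) -> M) : dt C t -> dt C s -> dt C (fun e => Funs (t e) (s e)).
Proof. by apply: dt2; rewrite /Funs; def. Qed.
End OperationsDt.

#[export] Hint Resolve dt_prod dt_Funs : def.

(** Class functions and classes definable from arbitrary parameters, to which replacement and
    separation apply. *)
Notation pfun F := (dt (@any _) (fun e => F (e 0))).
Notation pdef P := (dfn (@any _) (fun e => P (e 0))).

Section OperationSpecs.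
Variable M : zfc.
Implicit Types (x y z a b f p : M).
Let hM := zfc_axioms M.

Lemma in_emp z : ~ z ∈ emp.
Proof.
rewrite in_cpr //; have [e he] := empty_exists M; exists e => u.
by split=> // /he.
Qed.

Lemma in_pw x z : z ∈ pw x <-> subset z x.
Proof. apply: in_cpr; exact: (power hM). Qed.

Lemma in_Un x z : z ∈ Un x <-> exists y, y ∈ x /\ z ∈ y.
Proof. apply: in_cpr; exact: (union hM). Qed.

Lemma in_upr x y z : z ∈ upr x y <-> z = x \/ z = y.
Proof. apply: in_cpr; exact: (pairing hM). Qed.

Lemma in_cup x y z : z ∈ cup x y <-> z ∈ x \/ z ∈ y.
Proof.
rewrite in_Un; split=> [[u [/in_upr [->|->]]]|[h|h]]; [by left|by right|exists x|exists y];
by rewrite in_upr; tauto.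
Qed.

Lemma in_succ x z : z ∈ succ x <-> z ∈ x \/ z = x.
Proof. by rewrite in_cup in_upr; tauto. Qed.

Lemma upr_upair p x y : is_upair p x y <-> p = upr x y.
Proof.
split=> [h|->]; first by apply: set_ext => z; rewrite in_upr; apply: h.
exact: in_upr.
Qed.

Lemma opairE p x y : is_opair p x y <-> p = op x y.
Proof.
split=> [[s [t [/upr_upair -> [/upr_upair -> /upr_upair ->]]]]|->] //.
by exists (upr x x), (upr x y); rewrite !upr_upair.
Qed.

Lemma upr_inj x y x' y' : upr x y = upr x' y' -> (x = x' /\ y = y') \/ (x = y' /\ y = x').
Proof.
move=> h.
have h1 : x ∈ upr x' y' by rewrite -h in_upr; left.
have h2 : y ∈ upr x' y' by rewrite -h in_upr; right.
have h3 : x' ∈ upr x y by rewrite h in_upr; left.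
have h4 : y' ∈ upr x y by rewrite h in_upr; right.
move: h1 h2 h3 h4; rewrite !in_upr => -[] ? [] ? [] ? [] ?; subst; auto.
Qed.

Lemma op_inj x y x' y' : op x y = op x' y' -> x = x' /\ y = y'.
Proof.
move/upr_inj => [[/upr_inj h1 /upr_inj h2]|[/upr_inj h1 /upr_inj h2]];
by intuition congruence.
Qed.

Lemma relatedE f x y : related f x y <-> op x y ∈ f.
Proof.
split=> [[p [/opairE -> ]]|h] //; by exists (op x y); rewrite opairE.
Qed.

Lemma in_iteT (P : Prop) x y : P -> ite P x y = x.
Proof. by move=> h; symmetry; apply/cprE; left=> z; tauto. Qed.

Lemma in_iteF (P : Prop) x y : ~ P -> ite P x y = y.
Proof. by move=> h; symmetry; apply/cprE; left=> z; tauto. Qed.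

Lemma in_prod a b p : p ∈ prod a b <-> exists x y, x ∈ a /\ y ∈ b /\ p = op x y.
Proof.
apply: in_cpr; apply: (@small_sub _ _ (pw (pw (cup a b)))); first by def.
move=> q [x [y [hx [hy ->]]]]; apply/in_pw => u /in_upr hu; apply/in_pw => v.
by case: hu => ->; rewrite in_upr in_cup => -[] ->; tauto.
Qed.

Lemma in_lam a F p : pfun F -> p ∈ lam a F <-> exists x, x ∈ a /\ p = op x (F x).
Proof.
move=> hF; apply: in_cpr; apply: (small_image (R := fun x p => p = op x (F x))).
  apply: dfn_eq; first by def.
  by apply: dt_op; def; apply: (dt_ren (fun n => n)); def.
by move=> x y y' _ -> ->.
Qed.

Lemma op_in_lam a F x y : pfun F -> op x y ∈ lam a F <-> x ∈ a /\ y = F x.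
Proof.
move=> hF; rewrite in_lam //; split=> [[x' [hx /op_inj [-> ->]]]|[hx ->]] //.
by exists x.
Qed.

Lemma ap_lam a F x : pfun F -> x ∈ a -> ap (lam a F) x = F x.
Proof.
move=> hF hx; apply: the_eq; first by apply/op_in_lam.
by move=> y; rewrite op_in_lam // => -[].
Qed.

Lemma pfun_ap f : pfun (ap f).
Proof. by def. Qed.

Lemma lam_ext a F G : (forall x, x ∈ a -> F x = G x) -> lam a F = lam a G.
Proof.
by move=> h; apply: cpr_ext => p; split=> -[x [hx ->]]; exists x; rewrite h.
Qed.

Lemma lam_lam a F : pfun F -> lam a (ap (lam a F)) = lam a F.
Proof. by move=> hF; apply: lam_ext => x hx; apply: ap_lam. Qed.

Lemma in_Funs a b f : f ∈ Funs a b <-> f = lam a (ap f) /\ forall x, x ∈ a -> ap f x ∈ b.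
Proof.
apply: in_cpr; apply: (@small_sub _ _ (pw (prod a b))); first by def.
move=> g [hg hb]; apply/in_pw => p; rewrite hg (in_lam _ _ (pfun_ap g)).
move=> [x [hx ->]]; apply/in_prod; by exists x, (ap g x); auto.
Qed.

Lemma lam_Funs a b F : pfun F -> (forall x, x ∈ a -> F x ∈ b) -> lam a F ∈ Funs a b.
Proof.
move=> hF h; apply/in_Funs; rewrite lam_lam //; split=> // x hx.
by rewrite ap_lam //; apply: h.
Qed.

Lemma in_sep (P : M -> Prop) a z : pdef P -> z ∈ cpr (fun z => z ∈ a /\ P z) <-> z ∈ a /\ P z.
Proof.
move=> h; apply: (in_cpr (P := fun z => z ∈ a /\ P z)); exact: separate.
Qed.

Lemma in_image (F : M -> M) a y : pfun F ->
  y ∈ cpr (fun y => exists x, x ∈ a /\ y = F x) <-> exists x, x ∈ a /\ y = F x.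
Proof.
move=> hF; apply: (in_cpr (P := fun y => exists x, x ∈ a /\ y = F x)).
apply: (small_image (R := fun x y => y = F x)); last by move=> x y1 y2 _ -> ->.
by apply: dfn_eq; def; apply: (dt_ren (fun n => n)); def.
Qed.

Lemma in_bigcup (F : M -> M) a y : pfun F ->
  y ∈ Un (cpr (fun y => exists x, x ∈ a /\ y = F x)) <-> exists x, x ∈ a /\ y ∈ F x.
Proof.
move=> hF; rewrite in_Un; split=> [[z []]|[x [hx hy]]].
  by rewrite in_image // => -[x [hx ->]] hy; exists x.
by exists (F x); rewrite in_image //; split=> //; exists x.
Qed.

Lemma mem_irrefl x : ~ x ∈ x.
Proof.
move=> h; have [|y [/in_upr hy hy']] := foundation hM (x := upr x x).
  by exists x; rewrite in_upr; left.
have {}hy : y = x by case: hy.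
by subst; apply: (hy' x) => //; rewrite in_upr; left.
Qed.

Lemma mem_asym x y : x ∈ y -> ~ y ∈ x.
Proof.
move=> h1 h2; have [|z [/in_upr hz hz']] := foundation hM (x := upr x y).
  by exists x; rewrite in_upr; left.
by case: hz => ?; subst; [apply: (hz' y)|apply: (hz' x)] => //; rewrite in_upr; tauto.
Qed.

End OperationSpecs.
#[export] Hint Resolve pfun_ap : core.

(** * Ordinals and transfinite recursion *)

Section Ordinals.
Variable M : zfc.
Implicit Types (x y z a b c : M).
Let hM := zfc_axioms M.

Lemma dfn_ordinal C t : dt C t -> dfn C (fun e => ordinal (t e : M)).
Proof. by apply: dfn1; rewrite /ordinal /well_orders; def. Qed.
#[local] Hint Resolve dfn_ordinal : def.

Lemma subset_refl x : subset x x.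
Proof. by move=> z. Qed.

Lemma min_exists x : (exists y, y ∈ x) -> exists y, y ∈ x /\ forall z, z ∈ y -> ~ z ∈ x.
Proof. exact: (foundation hM). Qed.

Lemma ord_mem a x : ordinal a -> x ∈ a -> subset x a.
Proof. by move=> [h _]; apply: h. Qed.

Lemma ord_in a x : ordinal a -> x ∈ a -> ordinal x.
Proof.
move=> [hta [_ [htr [htot hmin]]]] hx.
have hxa := hta _ hx.
split=> [y hy z hz|].
  have hya := hxa _ hy; have hza := hta _ hya _ hz.
  exact: (htr z y x).
split=> [y _|]; first exact: mem_irrefl.
split=> [y z u hy hz hu|]; first by apply: htr; apply: hxa.
split=> [y z hy hz|b hb hne]; first by apply: htot; apply: hxa.
by apply: hmin => // u hu; apply: hxa; apply: hb.
Qed.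

Lemma ord_trans a x y : ordinal a -> x ∈ a -> y ∈ x -> y ∈ a.
Proof. by move=> ha hx; apply: ord_mem hx _. Qed.

Lemma ord_sub a b : ordinal a -> ordinal b -> subset a b -> a ∈ b \/ a = b.
Proof.
move=> ha hb hab; case: (classic (a = b)) => [|hne]; first by right.
left; set d := cpr (fun z => z ∈ b /\ ~ z ∈ a).
have hd z : z ∈ d <-> z ∈ b /\ ~ z ∈ a by apply: (in_sep (P := fun z => ~ z ∈ a)); def.
have [|m [/hd [hmb hma] hm]] := @min_exists d.
  apply: NNPP => hn; apply: hne; apply: set_ext => z; split=> [/hab|hz] //.
  by apply: NNPP => hz'; apply: hn; exists z; apply/hd.
suff -> : a = m by [].
apply: set_ext => z; split=> hz.
  case: (hb) => _ [_ [_ [htot _]]].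
  case: (htot z m (hab _ hz) hmb) => [|[e|e]] //; first by subst.
  by case: hma; apply: (ord_trans ha) e.
apply: NNPP => hza; apply: (hm z hz); apply/hd; split=> //.
exact: (ord_trans hb) hz.
Qed.

Lemma ord_cap a b : ordinal a -> ordinal b -> ordinal (cpr (fun z => z ∈ a /\ z ∈ b)).
Proof.
move=> ha hb; set d := cpr _.
have hd z : z ∈ d <-> z ∈ a /\ z ∈ b by apply: (in_sep (P := fun z => z ∈ b)); def.
case: (ha) => hta [_ [htr [htot hmin]]].
split=> [y /hd [h1 h2] z hz|].
  by apply/hd; split; [apply: ord_trans hz|apply: (ord_trans hb) hz].
split=> [y _|]; first exact: mem_irrefl.
split=> [y z u /hd [? _] /hd [? _] /hd [? _]|]; first by apply: htr.
split=> [y z /hd [? _] /hd [? _]|c hc]; first by apply: htot.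
by apply: hmin => u /hc /hd [].
Qed.

(** The intersection of [a] and [b] is an ordinal included in both, so it belongs to or equals each;
    belonging to both would make it a member of itself. *)
Lemma ord_tri a b : ordinal a -> ordinal b -> a ∈ b \/ a = b \/ b ∈ a.
Proof.
move=> ha hb; have hd := ord_cap ha hb; set d := cpr _ in hd.
have hdz z : z ∈ d <-> z ∈ a /\ z ∈ b by apply: (in_sep (P := fun z => z ∈ b)); def.
have h1 : d ∈ a \/ d = a by apply: ord_sub => // z /hdz [].
have h2 : d ∈ b \/ d = b by apply: ord_sub => // z /hdz [].
case: h1 h2 => [h1|h1] [h2|h2].
- by case: (@mem_irrefl _ d); apply/hdz.
- by right; right; rewrite -h2.
- by left; rewrite -h1.
- by right; left; rewrite -h1.
Qed.

Lemma ord_subE a b : ordinal a -> ordinal b -> subset a b <-> ord_le a b.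
Proof.
move=> ha hb; split=> [|[|->]]; [exact: ord_sub|exact: ord_mem|exact: subset_refl].
Qed.

Lemma ord_le_total a b : ordinal a -> ordinal b -> b ∈ a \/ subset a b.
Proof.
move=> ha hb; case: (ord_tri ha hb) => [h|[->|h]]; [right|right|by left].
  exact: ord_mem.
exact: subset_refl.
Qed.

Lemma ord_le_mem a b c : ordinal c -> subset a b -> b ∈ c -> ordinal a -> a ∈ c.
Proof.
move=> hc hab hb ha; case: (ord_sub ha (ord_in hc hb) hab) => [h|->] //.
exact: ord_trans h.
Qed.

(* Foundation reduces the well-order condition to totality. *)
Lemma ordinal_intro a : (forall x, x ∈ a -> ordinal x) ->
  (forall x, x ∈ a -> subset x a) -> ordinal a.
Proof.
move=> h1 h2; split=> //; split=> [y _|]; first exact: mem_irrefl.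
split=> [x y z _ _ hz hxy hyz|]; first by apply: (ord_trans (h1 _ hz)) hxy.
split=> [x y hx hy|b hb /min_exists [m [hm hmin]]].
  by apply: ord_tri; apply: h1.
exists m; split=> // x hx; case: (ord_tri (h1 _ (hb _ hm)) (h1 _ (hb _ hx))) => [|[]]; auto.
by move=> /hmin.
Qed.

Lemma ord_Un a : (forall x, x ∈ a -> ordinal x) -> ordinal (Un a).
Proof.
move=> h; apply: ordinal_intro => x /in_Un [y [hy hx]]; first exact: ord_in (h _ hy) hx.
by move=> z hz; apply/in_Un; exists y; split=> //; apply: ord_trans hz; auto.
Qed.

Lemma ord_succ a : ordinal a -> ordinal (succ a).
Proof.
move=> h; apply: ordinal_intro => x /in_succ [hx|->] //; first exact: ord_in hx.
  by move=> z hz; apply/in_succ; left; apply: ord_trans hz.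
by move=> z hz; apply/in_succ; left.
Qed.

Lemma ord_emp : ordinal (@emp M).
Proof. by apply: ordinal_intro => x /in_emp. Qed.

Lemma ord_cup a b : ordinal a -> ordinal b -> ordinal (cup a b).
Proof. by move=> ha hb; apply: ord_Un => x /in_upr [] ->. Qed.

Lemma ord_bigcup (F : M -> M) a : pfun F -> (forall x, x ∈ a -> ordinal (F x)) ->
  ordinal (Un (cpr (fun y => exists x, x ∈ a /\ y = F x))).
Proof. by move=> hF h; apply: ord_Un => y; rewrite in_image // => -[x [hx ->]]; auto. Qed.

Lemma succ_mem a b : ordinal b -> a ∈ b -> subset (succ a) b.
Proof. by move=> hb ha z /in_succ [hz|->] //; apply: ord_trans hz. Qed.

Lemma succ_mono a b : ordinal b -> a ∈ b -> succ a ∈ succ b.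
Proof.
move=> hb ha; apply/in_succ; apply: ord_sub => //; first exact/ord_succ/(ord_in hb).
exact: succ_mem.
Qed.

Lemma mem_succ a : a ∈ succ a.
Proof. by apply/in_succ; right. Qed.

Lemma ord_least (P : M -> Prop) : pdef P -> (exists a, ordinal a /\ P a) ->
  exists a, ordinal a /\ P a /\ forall b, b ∈ a -> ~ P b.
Proof.
move=> hP [a [ha hPa]].
case: (classic (exists b, b ∈ a /\ P b)) => [[b [hb hPb]]|hn]; last first.
  by exists a; split=> //; split=> // b hb hPb; apply: hn; exists b.
have [|m [/(in_sep _ _ hP) [hma hPm] hm]] := @min_exists (cpr (fun z => z ∈ a /\ P z)).
  by exists b; apply/in_sep.
exists m; split; first exact: ord_in hma.
split=> // c hc hPc; apply: (hm c hc); apply/in_sep => //; split=> //.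
exact: ord_trans hc.
Qed.

Lemma ord_ind (P : M -> Prop) : pdef P ->
  (forall a, ordinal a -> (forall b, b ∈ a -> P b) -> P a) -> forall a, ordinal a -> P a.
Proof.
move=> hP h a ha; apply: NNPP => hn.
have [||m [hm [hm1 hm2]]] := @ord_least (fun x => ~ P x).
- by def.
- by exists a.
- by apply: hm1; apply: h => // b /hm2 /NNPP.
Qed.

Definition least (P : M -> Prop) : M :=
  the (fun a => ordinal a /\ P a /\ forall b, b ∈ a -> ~ P b).

Lemma least_spec (P : M -> Prop) : pdef P -> (exists a, ordinal a /\ P a) ->
  ordinal (least P) /\ P (least P) /\ forall b, b ∈ least P -> ~ P b.
Proof.
move=> hP hex.
apply: (@the_spec _ (fun a => ordinal a /\ P a /\ forall b, b ∈ a -> ~ P b)).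
  exact: ord_least.
move=> x y [hx [hPx hx']] [hy [hPy hy']].
by case: (ord_tri hx hy) => [/hy'|[|/hx']].
Qed.

Lemma least_le (P : M -> Prop) a : pdef P -> ordinal a -> P a ->
  ordinal (least P) /\ P (least P) /\ subset (least P) a.
Proof.
move=> hP ha hPa; have [|h1 [h2 h3]] := least_spec hP; first by exists a.
by split=> //; split=> //; case: (ord_le_total h1 ha) => // /h3.
Qed.

Lemma dt_least C (P : M -> (nat -> M) -> Prop) :
  dfn C (fun e => P (e 0) (fun n => e (S n))) -> dt C (fun e => least (fun z => P z e)).
Proof.
move=> h.
have hS : dfn C (fun e => P (e 0) (fun n => e (S (S n)))) := dfn_ren (up_ren S) h.
apply: (dt_the (P := fun a e => ordinal a /\ P a e /\ forall b, b ∈ a -> ~ P b e)).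
by def.
Qed.

(** A run of the recursion up to [d]. The step [G] receives the set of all earlier values as a
    function, whose domain tells it the current stage. *)
Definition attempt (G : M -> M) f d : Prop :=
  ordinal d /\ f = lam d (ap f) /\ forall b, b ∈ d -> ap f b = G (lam b (ap f)).

Definition trans_rec (G : M -> M) a : M := the (fun y => exists f, attempt G f a /\ y = G f).

Lemma attempt_unique G f f' d : attempt G f d -> attempt G f' d -> f = f'.
Proof.
move=> [hd [h1 h2]] [_ [h1' h2']]; rewrite h1 h1'; apply: lam_ext.
suff h : forall x, ordinal x -> x ∈ d -> ap f x = ap f' x.
  by move=> x hx; apply: h => //; apply: ord_in hx.
apply: ord_ind; first by def.
move=> x hx IH hxd; rewrite h2 // h2' //; congr G; apply: lam_ext => y hy.
by apply: IH => //; apply: ord_trans hy.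
Qed.

Lemma trans_rec_attempt G f a : attempt G f a -> trans_rec G a = G f.
Proof.
move=> h; apply: the_eq; first by exists f.
by move=> y [f' [h' ->]]; rewrite (attempt_unique h' h).
Qed.

Lemma dfn_attempt C (G : M -> (nat -> M) -> M) t s : dt C t -> dt C s ->
  dt C (fun e => G (e 0) (fun n => e (S n))) ->
  dfn C (fun e => attempt (fun f => G f e) (t e) (s e)).
Proof.
move=> ht hs hG; rewrite /attempt.
have ht1 := dt_ren S ht; have hs1 := dt_ren S hs; have ht2 := dt_ren (fun n => S (S n)) ht.
apply: dfn_and; first by def.
apply: dfn_and; first by def.
apply: (dfn_all (P := fun b e => b ∈ s e -> ap (t e) b = G (lam b (ap (t e))) e)).
apply: dfn_imp; first by def.
apply: dfn_eq; first by def.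
have hG1 := dt_ren (up_ren S) hG.
have hl : dt C (fun e => lam (e 0) (ap (t (fun n => e (S n))))) by def.
(* [G] is an arbitrary definable term, so its argument [lam b (ap f)] has to be substituted into the
   graph of [G]. *)
exact: (dfn_ext (dfn_let (P := fun e => e 1 = G (e 0) (fun n => e (S (S (S n)))))
  (dfn_eq (dt_var _ 1) (dt_ren (fun n => match n with 0 => 0 | S n => S (S (S n)) end) hG))
  (dt_ren S hl)) (fun e => iff_refl _)).
Qed.

Lemma dt_trans_rec C (G : M -> (nat -> M) -> M) t : dt C t ->
  dt C (fun e => G (e 0) (fun n => e (S n))) -> dt C (fun e => trans_rec (fun f => G f e) (t e)).
Proof.
move=> ht hG; rewrite /trans_rec.
apply: (dt_the (P := fun y e => exists f, attempt (fun f => G f e) f (t e) /\ y = G f e)).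
apply: (dfn_ex (P := fun f e => attempt (fun f => G f (fun n => e (S n))) f
   (t (fun n => e (S n))) /\ e 0 = G f (fun n => e (S n)))).
have ht2 := dt_ren (fun n => S (S n)) ht.
have hG2 := dt_ren (up_ren S) hG.
apply: dfn_and; last by def.
apply: (dfn_attempt (G := fun f e => G f (fun n => e (S (S n))))) => //; first by def.
exact: (dt_ren (up_ren (fun n => S (S n))) hG).
Qed.

(** Induction on [a]: attempts on all smaller ordinals exist and are unique, so their values glue to
    an attempt on [a]. *)
Lemma attempt_exists G a : pfun G -> ordinal a -> attempt G (lam a (trans_rec G)) a.
Proof.
move=> hG.
have hR : pfun (trans_rec G).
  by apply: (dt_trans_rec (G := fun f e => G f)); def.
have hd : pdef (fun a => attempt G (lam a (trans_rec G)) a).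
  by apply: (dfn_attempt (G := fun f e => G f)); def; apply: dt_lam; def.
move: a; apply: (ord_ind hd) => a ha IH.
split=> //; split=> [|b hb]; first by rewrite lam_lam.
rewrite ap_lam // (trans_rec_attempt (IH _ hb)); congr G; apply: lam_ext => x hx.
by rewrite ap_lam //; apply: ord_trans hx.
Qed.

Lemma pfun_trans_rec G : pfun G -> pfun (trans_rec G).
Proof.
by move=> hG; apply: (dt_trans_rec (G := fun f e => G f)); def.
Qed.

Theorem trans_recE G a : pfun G -> ordinal a -> trans_rec G a = G (lam a (trans_rec G)).
Proof. by move=> hG ha; apply: trans_rec_attempt; apply: attempt_exists. Qed.

(** * The natural numbers of the model *)

Definition nat_like x : Prop := ordinal x /\ ~ limit_ordinal x /\
  forall y, y ∈ x -> ~ limit_ordinal y.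
Definition omega : M := cpr nat_like.

Lemma dfn_limit C t : dt C t -> dfn C (fun e => limit_ordinal (t e : M)).
Proof. by apply: dfn1; rewrite /limit_ordinal; def. Qed.
#[local] Hint Resolve dfn_limit : def.

Lemma dt_omega C : dt C (fun _ => omega).
Proof. by rewrite /omega /nat_like; def. Qed.

Lemma nat_like_in x y : nat_like x -> y ∈ x -> nat_like y.
Proof.
move=> [h1 [h2 h3]] hy; split; first exact: ord_in hy.
by split=> [|z hz]; apply: h3 => //; apply: ord_trans hz.
Qed.

Lemma not_limit x : ordinal x -> ~ limit_ordinal x -> x = emp \/ exists y, y ∈ x /\ x = succ y.
Proof.
move=> hx hl; case: (classic (exists y, y ∈ x)) => he; last first.
  left; apply: set_ext => z; split=> [hz|/in_emp] //; case: he; by exists z.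
right; apply: NNPP => hn; apply: hl; split=> //; split=> // y hy.
apply: NNPP => h; apply: hn; exists y; split=> //; apply: set_ext => z.
split=> [hz|]; last by apply: succ_mem.
apply/in_succ; case: (ord_tri (ord_in hx hz) (ord_in hx hy)) => [|[|h']]; auto.
by case: h; exists z.
Qed.

(** The class [nat_like] is a set because ordinal induction places each of its members, being zero
    or a successor, in the inductive set given by the axiom of infinity. *)
Lemma in_omega x : x ∈ omega <-> nat_like x.
Proof.
have hd : pdef nat_like by rewrite /nat_like; def.
apply: in_cpr; have [w [[e0 [he0 he]] hw]] := infinity hM.
have {e0 he}he0 : emp ∈ w.
  by suff -> : emp = e0 by []; apply: set_ext => z; split=> [/in_emp|/he].
have {}hw y : y ∈ w -> succ y ∈ w.
  move=> /hw [s [hs h]]; suff -> : succ y = s by [].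
  by apply: set_ext => z; rewrite in_succ h.
apply: (small_sub (a := w)) => // y hy; have ho : ordinal y by case: hy.
move: y ho hy; apply: ord_ind; first by def.
move=> y ho IH hy; case: (hy) => _ [hl _].
case: (not_limit ho hl) => [->|[z [hz ->]]] //.
by apply: hw; apply: IH => //; apply: nat_like_in hz.
Qed.

Lemma ord_omega : ordinal omega.
Proof.
apply: ordinal_intro => x /in_omega hx; first by case: hx.
by move=> z hz; apply/in_omega; apply: nat_like_in hz.
Qed.

Lemma omega_emp : emp ∈ omega.
Proof.
apply/in_omega; split; first exact: ord_emp.
by split=> [[_ [[y /in_emp]]]|y /in_emp].
Qed.

Lemma omega_succ x : x ∈ omega -> succ x ∈ omega.
Proof.
move=> /in_omega hx; case: (hx) => ho [hl hl']; apply/in_omega; split; first exact: ord_succ.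
split=> [[_ [_ h]]|y /in_succ [/hl'|->]] //.
have [z [/in_succ [hz|->] hz']] := h x (mem_succ x); last exact: mem_irrefl hz'.
exact: mem_asym hz hz'.
Qed.

Lemma omega_limit : limit_ordinal omega.
Proof.
split; first exact: ord_omega.
split; first by exists emp; apply: omega_emp.
by move=> y hy; exists (succ y); split; [apply: omega_succ|apply: mem_succ].
Qed.

Lemma omega_ind (P : M -> Prop) : pdef P -> P emp ->
  (forall n, n ∈ omega -> P n -> P (succ n)) -> forall n, n ∈ omega -> P n.
Proof.
move=> hP h0 hS n hn; have ho := ord_in ord_omega hn; move: n ho hn.
apply: ord_ind; first by apply: dfn_imp => //; apply: dfn_mem; [def|exact: dt_omega].
move=> n ho IH hn; case: (not_limit ho); first by case/in_omega: hn => _ [].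
  by move=> ->.
move=> [m [hm ?]]; subst; have hm' : m ∈ omega by apply: (ord_trans ord_omega hn).
by apply: hS => //; apply: IH.
Qed.

Lemma is_omegaE w : is_omega w <-> w = omega.
Proof.
split=> [[hl hn]|->]; last by split=> [|x /in_omega [_ []]]; first exact: omega_limit.
case: (hl) => ho _; case: (ord_tri ho ord_omega) => [|[|]] //.
  by move=> /in_omega [_ [h _]]; case: (h hl).
by move=> /hn h; case: (h omega_limit).
Qed.

Fixpoint num (i : nat) : M := match i with 0 => emp | S j => succ (num j) end.

Lemma num_omega i : num i ∈ omega.
Proof. by elim: i => [|i IH]; [apply: omega_emp|apply: omega_succ]. Qed.

Lemma dt_num C i : dt C (fun _ => num i).
Proof. by elim: i => [|i IH] /=; def. Qed.

End Ordinals.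

Arguments omega {M}.
Arguments num {M}.
#[export] Hint Resolve dfn_ordinal dfn_limit dt_omega dt_num : def.
#[export] Hint Extern 1 (dt _ (fun _ => least _)) => simple apply dt_least; cbv beta : def.
#[export] Hint Extern 1 (dt _ (fun _ => trans_rec _ _)) => simple apply dt_trans_rec; cbv beta : def.

(** * The cumulative hierarchy and reflection *)

Section Iteration.
Variable M : zfc.
Implicit Types (x y z a b c : M).

Lemma emp_succ x : emp <> succ x.
Proof. by move=> h; apply: (@in_emp _ x); rewrite h; apply: mem_succ. Qed.

Lemma Un_succ x : ordinal x -> Un (succ x) = x.
Proof.
move=> hx; apply: set_ext => z; rewrite in_Un; split=> [[y [/in_succ [hy|->]]]|hz] //.
  by move=> hz; apply: ord_trans hz.
by exists x; split=> //; apply: mem_succ.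
Qed.

Definition dom f : M := cpr (fun b => exists y, op b y ∈ f).

Lemma dt_dom C t : dt C t -> dt C (fun e => dom (t e)).
Proof. by apply: dt1; rewrite /dom; def. Qed.
#[local] Hint Resolve dt_dom : def.

Lemma dom_lam a F : pfun F -> dom (lam a F) = a.
Proof.
move=> hF; symmetry; apply/cprE; left=> z; split=> [hz|[y /(op_in_lam _ _ _ hF)]].
  by exists (F z); apply/op_in_lam.
by case.
Qed.

(** The history [f] at a successor stage has domain [succ n], whose union is the predecessor [n]; an
    empty history marks stage zero. *)
Definition iter (F : M -> M) x n : M :=
  trans_rec (fun f => ite (f = emp) x (F (ap f (Un (dom f))))) n.

Section Iter.
Variables (F : M -> M) (x : M).
Hypothesis hF : pfun F.

Lemma pfun_iter : pfun (iter F x).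
Proof.
apply: pfun_trans_rec; apply: dt_ite; [by def|by def|].
by apply: (dt1 (F := F)); def.
Qed.

Lemma iter_step_pfun : pfun (fun f => ite (f = emp) x (F (ap f (Un (dom f))))).
Proof. apply: dt_ite; [by def|by def|]; by apply: (dt1 (F := F)); def. Qed.

Lemma iter0 : iter F x emp = x.
Proof.
rewrite /iter trans_recE; [exact: iter_step_pfun|exact: ord_emp|].
rewrite in_iteT //; apply: set_ext => z; rewrite in_lam; first exact: pfun_iter.
by split=> [[u [/in_emp]]|/in_emp].
Qed.

Lemma iterS n : n ∈ omega -> iter F x (succ n) = F (iter F x n).
Proof.
move=> hn; have ho := ord_in (ord_omega M) hn.
rewrite /iter trans_recE; [exact: iter_step_pfun|exact: ord_succ|].
have hI := pfun_iter; rewrite /iter in hI.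
rewrite in_iteF; last by rewrite dom_lam // Un_succ // ap_lam //; apply: mem_succ.
move=> h; apply: (@in_emp _ (op n (iter F x n))); rewrite -h.
by apply/op_in_lam => //; split=> //; apply: mem_succ.
Qed.
End Iter.

Section Closure.
Variables (X : M -> Prop) (H : M -> M) (b0 : M).
Hypotheses (hX : pdef X) (hH : pfun H).
Hypotheses (Xord : forall a, X a -> ordinal a) (Xdown : forall a b, X a -> b ∈ a -> X b).
Hypotheses (Xsucc : forall a, X a -> X (succ a))
  (Xcup : forall a b, X a -> X b -> X (cup a b)) (XH : forall a, X a -> X (H a)).
Hypothesis Hmono : forall a b, X a -> X b -> subset a b -> subset (H a) (H b).
Hypothesis hb0 : X b0.

(** The map [x] to the maximum of [x + 1] and [H x + 1] is iterated from [b0 + 1], and [u] is the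
    supremum. If [b] is below an iterate, monotonicity puts [H b] below the next one. The sequence
    [s] is exported because, when [X] is the set of ordinals below a cardinal, the caller must bound
    it to see that [u] stays in [X]. *)
Lemma closure_point : exists s, pfun s /\ (forall n, n ∈ omega -> X (s n)) /\
  exists u, (forall y, y ∈ u <-> exists n, n ∈ omega /\ y ∈ s n) /\ ordinal u /\
    b0 ∈ u /\ forall b, b ∈ u -> succ b ∈ u /\ H b ∈ u.
Proof.
pose F x := cup (succ x) (succ (H x)).
have hF : pfun F by rewrite /F; def.
pose s := iter F (succ b0).
have hs : pfun s := pfun_iter (succ b0) hF.
have sX n : n ∈ omega -> X (s n).
  move: n; apply: omega_ind => //; first by apply: (dfn1 (Q := X)); def.
    by rewrite /s iter0 //; apply: Xsucc.
  by move=> n hn h; rewrite /s iterS //; apply: Xcup; apply: Xsucc => //; apply: XH.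
exists s; split=> //; split=> //.
exists (Un (cpr (fun y => exists n, n ∈ omega /\ y = s n))).
have hu y := @in_bigcup M s omega y hs.
split=> //; split; first by apply: ord_bigcup => // n hn; apply: Xord; apply: sX.
split; first by apply/hu; exists emp; rewrite /s iter0 //; split; [apply: omega_emp|apply: mem_succ].
move=> b /hu [n [hn hb]]; have hXn := sX n hn; have hXb := Xdown hXn hb.
have hS : s (succ n) = F (s n) by rewrite /s iterS.
split; apply/hu; exists (succ n); (split; first exact: omega_succ); rewrite hS; apply/in_cup.
  by left; apply: succ_mono => //; apply: Xord.
right; apply/in_succ; apply: ord_sub; try by apply/Xord/XH.
by apply: Hmono => //; apply: ord_mem => //; apply: Xord.
Qed.
End Closure.

End Iteration.
#[export] Hint Resolve dt_dom : def.

(** * Stages of the cumulative hierarchy *)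

Section Hierarchy.
Variable M : zfc.
Implicit Types (x y z a b c : M).

Definition V_step f : M := cpr (fun z => exists d u, op d u ∈ f /\ subset z u).
Definition V a : M := trans_rec V_step a.

Lemma dt_V C t : dt C t -> dt C (fun e => V (t e)).
Proof. by apply: dt1; rewrite /V /V_step; def. Qed.
#[local] Hint Resolve dt_V : def.

Lemma in_V a z : ordinal a -> z ∈ V a <-> exists d, d ∈ a /\ subset z (V d).
Proof.
move=> ha; have hV : pfun V by def.
have hG : pfun V_step by rewrite /V_step; def.
rewrite /V trans_recE // /V_step in_cpr; last first.
  split=> [[d [u [/op_in_lam h hz]]]|[d [hd hz]]].
    by have [//|hd e] := h; exists d; rewrite -e.
  by exists d, (V d); split=> //; apply/op_in_lam.
apply: (small_sub (a := pw (Un (Un (Un (lam a (trans_rec V_step))))))); first by def.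
move=> y [d [u [hdu hy]]]; apply/in_pw => v /hy hv; apply/in_Un; exists u; split=> //.
apply/in_Un; exists (upr d u); rewrite in_upr; split; last by right.
by apply/in_Un; exists (op d u); split=> //; apply/in_upr; right.
Qed.

Lemma V_mono a b : ordinal a -> ordinal b -> subset a b -> subset (V a) (V b).
Proof. by move=> ha hb hab z; rewrite !in_V // => -[d [hd hz]]; exists d; auto. Qed.

Lemma V_trans a x y : ordinal a -> x ∈ V a -> y ∈ x -> y ∈ V a.
Proof.
move=> ha /(in_V _ ha) [d [hd hx]] /hx; apply: V_mono => //; first exact: ord_in hd.
exact: ord_mem.
Qed.

Lemma sub_V_succ a x : ordinal a -> subset x (V a) -> x ∈ V (succ a).
Proof.
by move=> ha hx; apply/in_V; [apply: ord_succ|exists a; split=> //; apply: mem_succ].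
Qed.

Lemma ord_sub_V a : ordinal a -> subset a (V a).
Proof.
move: a; apply: ord_ind; first by def.
move=> a ha IH b hb; apply/in_V => //; exists b; split=> //; exact: IH.
Qed.

Definition rank x : M := least (fun a => x ∈ V a).

(** Let [T] be the transitive closure of the singleton of [x]. A minimal element of [T] outside all
    stages would have all its members in stages, and the supremum of their ranks yields a stage
    containing it. *)
Lemma V_exhaust x : exists a, ordinal a /\ x ∈ V a.
Proof.
have hU : pfun (@Un M) by def.
pose t := iter (@Un M) (upr x x).
have ht : pfun t := pfun_iter (upr x x) hU.
set T := Un (cpr (fun y => exists n, n ∈ omega /\ y = t n)).
have hT y : y ∈ T <-> exists n, n ∈ omega /\ y ∈ t n := @in_bigcup M t omega y ht.
have Ttr y z : y ∈ T -> z ∈ y -> z ∈ T.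
  move=> /hT [n [hn hy]] hz; apply/hT; exists (succ n); split; first exact: omega_succ.
  by rewrite /t iterS //; apply/in_Un; exists y.
have xT : x ∈ T.
  by apply/hT; exists emp; rewrite /t iter0 // in_upr; split; [apply: omega_emp|left].
pose P y := exists a, ordinal a /\ y ∈ V a.
suff h y : y ∈ T -> P y by apply: h.
move=> hy; apply: NNPP => hn.
have hd : pdef (fun y => ~ P y) by rewrite /P; def.
have [|m [/(in_sep _ _ hd) [hm hPm] hmin]] := @min_exists _ (cpr (fun y => y ∈ T /\ ~ P y)).
  by exists y; apply/in_sep.
have hmP z : z ∈ m -> P z.
  move=> hz; apply: NNPP => h; apply: (hmin z hz); apply/in_sep => //; split=> //.
  exact: Ttr hz.
have hr : pfun rank by rewrite /rank; def.
have hrz z : z ∈ m -> ordinal (rank z) /\ z ∈ V (rank z).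
  by move=> /hmP h; have [||h1 [h2 _]] := @least_spec _ (fun a => z ∈ V a); def.
set a := Un (cpr (fun y => exists z, z ∈ m /\ y = rank z)).
have ha : ordinal a by apply: ord_bigcup => // z /hrz [].
apply: hPm; exists (succ a); split; first exact: ord_succ.
apply: sub_V_succ => // z hz; have [h1 h2] := hrz z hz.
apply: (V_mono h1) h2 => // u hu; apply/in_bigcup => //; by exists z.
Qed.

Lemma rank_spec x : ordinal (rank x) /\ x ∈ V (rank x).
Proof.
have [||h1 [h2 _]] := @least_spec _ (fun a => x ∈ V a); first by def.
  exact: V_exhaust.
by [].
Qed.

Lemma V_cover x : exists a, ordinal a /\ subset x (V a).
Proof.
have [h1 h2] := rank_spec x; exists (rank x); split=> // z; exact: V_trans.
Qed.

(** The witness in [is_stage] agrees with [V] on all ordinals up to [b] by induction; conversely,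
    [V] restricted to [succ b] is such a witness. *)
Lemma stageE b v : ordinal b -> is_stage b v <-> v = V b.
Proof.
move=> hb; have hV : pfun V by def.
have hle c : ord_le c b <-> c ∈ succ b by rewrite in_succ.
split=> [[f [hf [h1 /relatedE h2]]]|->]; last first.
  exists (lam (succ b) V); split.
    by move=> x y y'; rewrite !relatedE !op_in_lam // => -[_ ->] [_ ->].
  split; last by rewrite relatedE op_in_lam //; split=> //; apply: mem_succ.
  move=> c /hle hc; have hco := ord_in (ord_succ hb) hc.
  exists (V c); rewrite relatedE op_in_lam //; split=> // z; rewrite in_V //.
  split=> [[d [hd hz]]|[d [u [hd [/relatedE /op_in_lam h hz]]]]].
    exists d, (V d); rewrite relatedE op_in_lam //; do !split => //.
    exact: ord_trans (ord_succ hb) hc hd.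
  by have [//|_ e] := h; exists d; rewrite -e.
suff h c : ordinal c -> c ∈ succ b -> op c (V c) ∈ f.
  by apply: (hf b); apply/relatedE => //; apply: h => //; apply: mem_succ.
move: c; apply: ord_ind; first by def.
move=> c hc IH hcb; have [|y [/relatedE hy hz]] := h1 c; first exact/hle.
suff <- : y = V c by [].
have hcd d : d ∈ c -> op d (V d) ∈ f.
  by move=> hd; apply: IH => //; apply: ord_trans hd => //; apply: ord_succ.
apply: set_ext => z; rewrite hz in_V //; split=> [[d [u [hd [hu hzu]]]]|[d [hd hzd]]].
  exists d; split=> //; rewrite -(hf d u (V d)) //; apply/relatedE; exact: hcd.
by exists d, (V d); rewrite relatedE; auto.
Qed.

(* An assignment [s : omega -> V b] stands for the environment [env s]. *)
Definition acons x s : M := lam omega (fun n => ite (n = emp) x (ap s (Un n))).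
Definition aconst x : M := lam omega (fun _ => x).
Definition env s (i : nat) : M := ap s (num i).

Lemma dt_acons C t s : dt C t -> dt C s -> dt C (fun e => acons (t e) (s e)).
Proof. by apply: dt2; rewrite /acons; def. Qed.
Lemma dt_aconst C t : dt C t -> dt C (fun e => aconst (t e)).
Proof. by apply: dt1; rewrite /aconst; def. Qed.

Lemma env_acons x s : env (acons x s) = scons x (env s).
Proof.
apply: functional_extensionality => -[|i] /=; rewrite /env /acons ap_lam; def.
- exact: num_omega 0.
- by rewrite in_iteT.
- exact: num_omega (S i).
- rewrite in_iteF; first by move=> h; apply: (@emp_succ M (num i)).
  by rewrite Un_succ //; apply: ord_in (ord_omega M) (num_omega M i).
Qed.

Lemma env_aconst x : env (aconst x) = (fun _ => x).
Proof.
apply: functional_extensionality => i; rewrite /env /aconst ap_lam //; first by def.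
exact: num_omega.
Qed.

Lemma acons_Funs x s a : x ∈ a -> s ∈ Funs omega a -> acons x s ∈ Funs omega a.
Proof.
move=> hx /in_Funs [_ hs]; apply: lam_Funs; first by def.
move=> n hn; case: (classic (n = emp)) => he; first by rewrite in_iteT.
rewrite in_iteF //; apply: hs.
have /in_omega [ho [hl _]] := hn; case: (not_limit ho hl) => // -[m [hm ->]].
by rewrite Un_succ; [exact: ord_in hm|apply: ord_trans hm => //; apply: ord_omega].
Qed.

Lemma aconst_Funs x a : x ∈ a -> aconst x ∈ Funs omega a.
Proof. by move=> hx; apply: lam_Funs; def. Qed.

Lemma assignment_exists (l : list M) z a : z ∈ a -> (forall x, In x l -> x ∈ a) ->
  exists s, s ∈ Funs omega a /\ env s = app_env l (fun _ => z).
Proof.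
move=> hz; elim: l => [|x l IH] hl /=.
  by exists (aconst z); rewrite env_aconst; split=> //; apply: aconst_Funs.
have [|s [hs he]] := IH; first by move=> y hy; apply: hl; right.
exists (acons x s); rewrite env_acons he; split=> //; apply: acons_Funs => //.
by apply: hl; left.
Qed.

(** An environment outside the model need not be coded by a set. Finite support lets it be replaced
    by an environment that is. *)
Lemma sat_support (X : M -> Prop) phi : exists N, forall e e' : nat -> M,
  (forall n, n < N -> e n = e' n) -> sat_in X phi e <-> sat_in X phi e'.
Proof.
elim: phi => [i j|i j|p [N hN]|p [N hN] q [N' hN']|p [N hN]] /=.
- by exists (S (i + j)) => e e' h; rewrite !h //; lia.
- by exists (S (i + j)) => e e' h; rewrite !h //; lia.
- by exists N => e e' h; rewrite (hN e e').
- exists (N + N') => e e' h; rewrite (hN e e'); first by move=> n hn; apply: h; lia.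
  by rewrite (hN' e e') // => n hn; apply: h; lia.
- have E e e' : (forall n, n < N -> e n = e' n) -> forall x : M, sat_in X p (scons x e) ->
    sat_in X p (scons x e').
    move=> h x; rewrite (hN _ (scons x e')) // => -[|n] hn //=; apply: h; lia.
  exists N => e e' h; split=> -[x [hx hs]]; exists x; split=> //; apply: E hs => // n hn.
  by symmetry; apply: h.
Qed.

(** * The reflection principle *)

Definition reflects (phi : formula) b : Prop := forall e, (forall n, e n ∈ V b) ->
  sat phi e <-> sat_in (fun y => y ∈ V b) phi e.

Definition mono_class (H : M -> M) : Prop := pfun H /\ (forall a, ordinal a -> ordinal (H a)) /\
  forall a b, ordinal a -> ordinal b -> subset a b -> subset (H a) (H b).

Lemma mono_class_cup H H' : mono_class H -> mono_class H' ->
  mono_class (fun a => cup (H a) (H' a)).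
Proof.
move=> [h1 [h2 h3]] [h1' [h2' h3']]; split; first by apply: dt_cup.
split=> [a ha|a b ha hb hab z /in_cup hz]; first by apply: ord_cup; auto.
by apply/in_cup; case: hz => hz; [left; apply: (h3 a)|right; apply: (h3' a)].
Qed.

Lemma dfn_satenv C phi t s : dt C t -> dt C s ->
  dfn C (fun e => sat phi (scons (t e : M) (env (s e)))).
Proof.
move=> ht hs.
apply: dfn_ext (dfn_sat (C := C) phi (t := fun i => match i with 0 => t
  | S j => fun e => ap (s e) (num j) end) _) _; first by case=> [|i]; def.
move=> e; set f := fun i => _; suff -> : f = scons (t e) (env (s e)) by [].
by apply: functional_extensionality => -[].
Qed.
#[local] Hint Resolve dfn_satenv : def.

Definition wit_bound phi a c : Prop := forall s, s ∈ Funs omega (V a) ->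
  (exists x, sat phi (scons x (env s))) -> exists x, x ∈ V c /\ sat phi (scons x (env s)).

(** The assignments into [V a] form a set, so the least ranks of witnesses for them have a
    supremum. *)
Lemma wit_bound_exists phi a : exists c, ordinal c /\ wit_bound phi a c.
Proof.
pose R s := least (fun c => exists x, x ∈ V c /\ sat phi (scons x (env s))).
have hR : pfun R by rewrite /R; def.
pose Q s := exists x, sat phi (scons x (env s)).
have hQ : pdef Q by rewrite /Q; def.
have hRs s : Q s -> ordinal (R s) /\ exists x, x ∈ V (R s) /\ sat phi (scons x (env s)).
  move=> [x hx]; have [h1 h2] := rank_spec x.
  have [||h3 [h4 _]] := @least_spec _ (fun c => exists x, x ∈ V c /\ sat phi (scons x (env s))).
  by def.
  by exists (rank x); split=> //; exists x.
  by split.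
set d := cpr (fun s => s ∈ Funs omega (V a) /\ Q s).
have hd s : s ∈ d <-> s ∈ Funs omega (V a) /\ Q s := in_sep _ _ hQ.
set c := Un (cpr (fun y => exists s, s ∈ d /\ y = R s)).
have hc : ordinal c by apply: ord_bigcup => // s /hd [_ /hRs []].
exists c; split=> // s hs hqs; have [h1 [x [h2 h3]]] := hRs s hqs.
exists x; split=> //; apply: (V_mono h1) h2 => // u hu; apply/in_bigcup => //.
by exists s; split=> //; apply/hd.
Qed.

Lemma V_list b (l : list M) : ordinal b -> (exists a, a ∈ b) ->
  (forall a, a ∈ b -> succ a ∈ b) -> (forall x, In x l -> x ∈ V b) ->
  exists a, a ∈ b /\ forall x, In x l -> x ∈ V a.
Proof.
move=> hb hne hS; elim: l => [|x l IH] hl; first by case: hne => a ha; exists a.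
have [|a [ha hla]] := IH; first by move=> y hy; apply: hl; right.
have /(in_V _ hb) [d [hd hxd]] := hl x (or_introl eq_refl).
have hda := ord_in hb ha; have hdd := ord_succ (ord_in hb hd).
have hx := sub_V_succ (ord_in hb hd) hxd.
case: (ord_le_total hda hdd) => h.
  exists a; split=> // y [<-|/hla //]; apply: V_mono hx => //; exact: ord_mem.
by exists (succ d); split; [apply: hS|move=> y [<-|/hla] //; apply: V_mono].
Qed.

(** Induction on the formula. At an existential quantifier the new function [H2] bounds the ranks of
    witnesses for parameters in [V a]; at a closure point [b] such witnesses are found inside [V b],
    as in the Tarski-Vaught test. *)
Lemma reflection_club phi : exists H, mono_class H /\ forall b, ordinal b ->
  (exists a, a ∈ b) -> (forall a, a ∈ b -> succ a ∈ b /\ H a ∈ b) -> reflects phi b.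
Proof.
elim: phi => [i j|i j|p [H [hH hr]]|p [H [hH hr]] q [H' [hH' hr']]|p [H [hH hr]]].
- by exists (fun a => a); split; [split=> //; def|].
- by exists (fun a => a); split; [split=> //; def|].
- by exists H; split=> // b hb hne hcl e he; move: (hr b hb hne hcl e he); rewrite /sat /= => ->.
- exists (fun a => cup (H a) (H' a)); split; first exact: mono_class_cup.
  move=> b hb hne hcl.
  have hc a : a ∈ b -> (succ a ∈ b /\ H a ∈ b) /\ (succ a ∈ b /\ H' a ∈ b).
    move=> ha; have [h1 h2] := hcl a ha; have hao := ord_in hb ha.
    case: hH hH' => _ [h3 _] [_ [h3' _]].
    have h4 : H a ∈ b by apply: (ord_le_mem hb _ h2); auto => z hz; apply/in_cup; left.
    have h4' : H' a ∈ b by apply: (ord_le_mem hb _ h2); auto => z hz; apply/in_cup; right.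
    by [].
  move=> e he; move: (hr b hb hne (fun a ha => proj1 (hc a ha)) e he).
  move: (hr' b hb hne (fun a ha => proj2 (hc a ha)) e he).
  by rewrite /sat /= => -> ->.
- pose H2 a := least (wit_bound p a).
  have hwd a : pdef (wit_bound p a) by rewrite /wit_bound; def; apply: dt_Funs; def.
  have hw a : ordinal (H2 a) /\ wit_bound p a (H2 a).
    have [|h1 [h2 _]] := least_spec (hwd a); first exact: wit_bound_exists.
    by [].
  have hH2 : mono_class H2.
    split; first by rewrite /H2 /wit_bound; def.
    split=> [a _|a b ha hb hab]; first by case: (hw a).
    have [h1 h2] := hw b; have [|_ [_ //]] := least_le (hwd a) h1.
    move=> s /in_Funs [hs1 hs2]; apply: h2; apply/in_Funs; split=> // n hn.
    by apply: (V_mono ha hb hab); apply: hs2.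
  exists (fun a => cup (H a) (H2 a)); split; first exact: mono_class_cup.
  move=> b hb hne hcl.
  have hc a : a ∈ b -> succ a ∈ b /\ H a ∈ b.
    move=> ha; have [h1 h2] := hcl a ha; have hao := ord_in hb ha; split=> //.
    case: hH => _ [h3 _]; apply: (ord_le_mem hb _ h2); auto => z hz.
    by apply/in_cup; left.
  have hc2 a : a ∈ b -> H2 a ∈ b.
    move=> ha; have [h1 h2] := hcl a ha; have hao := ord_in hb ha.
    have [h3 _] := hw a; apply: (ord_le_mem hb _ h2); auto => z hz.
    by apply/in_cup; right.
  have hrp := hr b hb hne hc.
  have hrs x e : x ∈ V b -> (forall n, e n ∈ V b) ->
     sat p (scons x e) <-> sat_in (fun y => y ∈ V b) p (scons x e).
    by move=> hx he; apply: hrp => -[|n] /=.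
  move=> e he; split=> [[x [_ hx]]|[x [hx hs]]]; last by exists x; split=> //; apply/hrs.
  (* Only finitely many values of [e] matter, and as [b] is closed under successors they lie in one
     [V a] with [a] below [b]. The list has length [S N], so it always contains the default value
     [e 0]. *)
  have [N hN] := sat_support (fun _ : M => True) p.
  have [||a [ha hla]] := @V_list b (map e (List.seq 0 (S N))) hb hne.
    by move=> a /hc [].
    by move=> y /in_map_iff [n [<- _]].
  have [||s [hs hse]] := @assignment_exists (map e (List.seq 0 (S N))) (e 0) (V a).
    by apply: hla; left.
    by [].
  have hE y : sat p (scons y (env s)) <-> sat p (scons y e).
    apply: hN => -[|n] hn //=; rewrite hse (app_env_nth _ (e 0)) ?length_map ?length_seq //.
      by lia.
    by rewrite map_nth seq_nth //; lia.
  have [_ h2] := hw a; have [|y [hy hys]] := h2 s hs; first by exists x; apply/hE.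
  have hyb : y ∈ V b.
    have h3 := hc2 a ha; apply: (V_mono (ord_in hb h3) hb (ord_mem hb h3)) hy.
  by exists y; split=> //; apply/hrs => //; apply/hE.
Qed.

Lemma reflection phi a : ordinal a -> exists b, ordinal b /\ a ∈ b /\ reflects phi b.
Proof.
move=> ha; have [H [[h1 [h2 h3]] hr]] := reflection_club phi.
have [|s [_ [_ [u [_ [hu [hau hcl]]]]]]] :=
  @closure_point M (@ordinal M) H a _ h1 (fun a h => h) (@ord_in M) (@ord_succ M)
   (@ord_cup M) h2 h3 ha; first by def.
by exists u; split=> //; split=> //; apply: hr => //; exists a.
Qed.

(** Definability over the whole model from ordinals is reflected to a stage [V b] that contains the
    parameters and includes [x]. *)
Theorem OD_definable x (P : M -> Prop) : dfn (@ordinal M) (fun e => P (e 0)) ->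
  (forall z, z ∈ x <-> P z) -> OD x.
Proof.
move=> [phi [l [hl h]]] hx.
(* The parameters move from the slots starting at 0 to those starting at 1; every other variable
   becomes variable 0, that is [z]. *)
pose psi := ren (fun n => if n <? length l then S n else 0) phi.
have hpsi z : sat psi (fun i => nth i (z :: l) z) <-> P z.
  rewrite /psi /sat sat_in_ren -(h (fun _ => z)) /sat.
  suff -> : (fun n => nth (if n <? length l then S n else 0) (z :: l) z) =
    app_env l (fun _ => z) by [].
  apply: functional_extensionality => n; case: Nat.ltb_spec => hn.
    by rewrite (app_env_nth _ z).
  have -> : n = length l + (n - length l) by lia.
  by rewrite app_env_shift.
have [c [hc hxc]] := V_cover x.
have [d [hd hld]] : exists d, ordinal d /\ forall a, In a l -> a ∈ d.
  elim: {h psi hpsi} l hl => [|y l IH] hl; first by exists emp; split=> //; apply: ord_emp.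
  inversion hl; subst; have [//|d [hd hld]] := IH.
  exists (cup (succ y) d); split; first by apply: ord_cup => //; apply: ord_succ.
  by move=> a [->|/hld ha]; apply/in_cup; [left; apply: mem_succ|right].
have hcd := ord_cup hc hd.
have [b [hb [hcb hr]]] := reflection psi hcd.
have hcdb : subset (V (cup c d)) (V b) by apply: V_mono => //; apply: ord_mem.
have hxb z : z ∈ x -> z ∈ V b.
  by move=> /hxc hz; apply: hcdb; apply: (V_mono hc) hz => // u hu; apply/in_cup; left.
have hlb a : In a l -> a ∈ V b.
  by move=> /hld ha; apply: hcdb; apply: (ord_sub_V hcd); apply/in_cup; right.
exists psi, b, (V b), l; split=> //; split; first exact/stageE.
split=> [a ha|z]; first by split; [move/Forall_forall: hl; apply|apply: hlb].
have E : z ∈ V b -> sat psi (fun i => nth i (z :: l) z) <->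
    sat_in (fun y => y ∈ V b) psi (fun i => nth i (z :: l) z).
  move=> hz; apply: hr => n; case: (Nat.lt_ge_cases n (length (z :: l))) => hn.
    by case: (nth_In (z :: l) z hn) => [<-|] //; apply: hlb.
  by rewrite nth_overflow.
split=> [hz|[hz /E /hpsi hP]]; last by apply/hx/hP.
by split; [apply: hxb|apply/E; [apply: hxb|apply/hpsi/hx]].
Qed.

End Hierarchy.
#[export] Hint Resolve dt_V dt_acons dt_aconst : def.

(** * A definable enumeration of the ordinal definable sets *)

Section Enumeration.
Variable M : zfc.
Implicit Types (x y z a b c d f X Y : M).

(** Otherwise replacement along the inverse of [F] would collect all ordinals into a set. This is
    what stops the recursions that keep adding new elements of a fixed set. *)
Lemma no_ord_injection (F : M -> M) B : pfun F -> (forall a, ordinal a -> F a ∈ B) ->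
  (forall a c, ordinal a -> c ∈ a -> F c <> F a) -> False.
Proof.
move=> hF hB hinj.
have hs : small (fun a => exists y, y ∈ B /\ (ordinal a /\ y = F a)).
  apply: (small_image (R := fun y a => ordinal a /\ y = F a)).
    by apply: dfn_and; [def|apply: dfn_eq; [def|apply: (dt1 (F := F)); def]].
  move=> y a a' _ [ha ->] [ha' h].
  case: (ord_tri ha ha') => [h'|[|h']] //.
    by case: (hinj a' a ha' h').
  by case: (hinj a a' ha h').
have [O hO] := hs.
have {}hO a : a ∈ O <-> ordinal a.
  rewrite hO; split=> [[y [_ [ha _]]]|ha] //; exists (F a); auto.
apply: (@mem_irrefl _ O); apply/hO; apply: ordinal_intro => a /hO // ha c hc.
by apply/hO; apply: ord_in hc.
Qed.

(** A formula over [V b] is represented by the set of assignments satisfying it; the operations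
    below mirror the atomic formulas and the logical connectives on such sets. *)
Definition assigns b : M := Funs omega (V b).
Definition opMem b d e : M := cpr (fun s => s ∈ assigns b /\ ap s d ∈ ap s e).
Definition opEq b d e : M := cpr (fun s => s ∈ assigns b /\ ap s d = ap s e).
Definition opNand b X Y : M := cpr (fun s => s ∈ assigns b /\ ~ (s ∈ X /\ s ∈ Y)).
Definition opEx b X : M := cpr (fun s => s ∈ assigns b /\ exists x, x ∈ V b /\ acons x s ∈ X).
(* Ordinal parameters enter the enumeration only through this operation. *)
Definition opInst b a X : M := cpr (fun s => s ∈ assigns b /\ acons a s ∈ X).

Lemma dt_assigns C t : dt C t -> dt C (fun e => assigns (t e)).
Proof. by apply: dt1; rewrite /assigns; def. Qed.
#[local] Hint Resolve dt_assigns : def.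
Lemma dt_opMem C t s u : dt C t -> dt C s -> dt C u -> dt C (fun e => opMem (t e) (s e) (u e)).
Proof. by apply: dt3; rewrite /opMem; def. Qed.
Lemma dt_opEq C t s u : dt C t -> dt C s -> dt C u -> dt C (fun e => opEq (t e) (s e) (u e)).
Proof. by apply: dt3; rewrite /opEq; def. Qed.
Lemma dt_opNand C t s u : dt C t -> dt C s -> dt C u -> dt C (fun e => opNand (t e) (s e) (u e)).
Proof. by apply: dt3; rewrite /opNand; def. Qed.
Lemma dt_opEx C t s : dt C t -> dt C s -> dt C (fun e => opEx (t e) (s e)).
Proof. by apply: dt2; rewrite /opEx; def. Qed.
Lemma dt_opInst C t s u : dt C t -> dt C s -> dt C u -> dt C (fun e => opInst (t e) (s e) (u e)).
Proof. by apply: dt3; rewrite /opInst; def. Qed.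
#[local] Hint Resolve dt_opMem dt_opEq dt_opNand dt_opEx dt_opInst : def.

Definition old f X : Prop := exists c, op c X ∈ f.

Lemma dfn_old C t s : dt C t -> dt C s -> dfn C (fun e => old (t e) (s e)).
Proof. by apply: dfn2; rewrite /old; def. Qed.
#[local] Hint Resolve dfn_old : def.

(* The first operation with a value outside the range of [f].  At indices outside
   the domain of [f] the arguments are junk, which only adds definable sets. *)
Definition pick b f d e : M :=
  ite (~ old f (opMem b d e)) (opMem b d e)
  (ite (~ old f (opEq b d e)) (opEq b d e)
  (ite (~ old f (opNand b (ap f d) (ap f e))) (opNand b (ap f d) (ap f e))
  (ite (~ old f (opEx b (ap f d))) (opEx b (ap f d)) (opInst b e (ap f d))))).

Lemma dt_pick C t s u v : dt C t -> dt C s -> dt C u -> dt C v ->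
  dt C (fun e => pick (t e) (s e) (u e) (v e)).
Proof.
move=> h1 h2 h3 h4.
by rewrite /pick; def.
Qed.
#[local] Hint Resolve dt_pick : def.

Lemma pick_cases (R : M -> Prop) b f d e : R (opMem b d e) -> R (opEq b d e) ->
  R (opNand b (ap f d) (ap f e)) -> R (opEx b (ap f d)) -> R (opInst b e (ap f d)) ->
  R (pick b f d e).
Proof.
move=> h1 h2 h3 h4 h5; rewrite /pick.
by repeat match goal with |- R (ite ?P ?x ?y) => let h := fresh in
  case: (classic P); intro h; [rewrite (in_iteT x y h)|rewrite (in_iteF x y h)] end.
Qed.

(** [pick] returns an old set only after all other candidates have turned out old, so a stage where
    nothing is fresh is closed under all five operations. *)
Lemma pick_old b f d e : old f (pick b f d e) ->
  old f (opMem b d e) /\ old f (opEq b d e) /\ old f (opNand b (ap f d) (ap f e)) /\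
  old f (opEx b (ap f d)) /\ old f (opInst b e (ap f d)).
Proof.
rewrite /pick; repeat match goal with |- old f (ite ?P ?x ?y) -> _ => let h := fresh in
  case: (classic P); intro h; [by rewrite (in_iteT x y h)|rewrite (in_iteF x y h)] end.
by move=> ?; do !split; try apply: NNPP.
Qed.

Definition fresh b f : Prop :=
  exists d, ordinal d /\ exists e, ordinal e /\ ~ old f (pick b f d e).

(** Together with the least [e] in [enum_step] this selects the lexicographically least pair of
    arguments giving a new set, so the enumeration is definable from [b] alone. *)
Definition first_d b f : M := least (fun d => exists e, ordinal e /\ ~ old f (pick b f d e)).
Definition enum_step b f : M :=
  pick b f (first_d b f) (least (fun e => ~ old f (pick b f (first_d b f) e))).
Definition enum_sets b c : M := trans_rec (enum_step b) c.

Lemma dt_first_d C t s : dt C t -> dt C s -> dt C (fun e => first_d (t e) (s e)).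
Proof. by apply: dt2; rewrite /first_d; def. Qed.
#[local] Hint Resolve dt_first_d : def.
Lemma dt_enum_step C t s : dt C t -> dt C s -> dt C (fun e => enum_step (t e) (s e)).
Proof. by apply: dt2; rewrite /enum_step; def. Qed.
#[local] Hint Resolve dt_enum_step : def.
Lemma dt_enum_sets C t s : dt C t -> dt C s -> dt C (fun e => enum_sets (t e) (s e)).
Proof. by apply: dt2; rewrite /enum_sets; def. Qed.
#[local] Hint Resolve dt_enum_sets : def.

Lemma enum_step_fresh b f : fresh b f -> ~ old f (enum_step b f).
Proof.
move=> hf; have [|_ [hd _]] := @least_spec _ (fun d => exists e, ordinal e /\
  ~ old f (pick b f d e)) _ hf; first by def.
by have [|_ [he _]] := @least_spec _ (fun e => ~ old f (pick b f (first_d b f) e)) _ hd; def.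
Qed.

Lemma pick_sub b f d e : subset (pick b f d e) (assigns b).
Proof.
by apply: (@pick_cases (fun X => subset X (assigns b))) => s; rewrite in_sep; def; case.
Qed.

Lemma old_enum_sets b a X : old (lam a (enum_sets b)) X <-> exists c, c ∈ a /\ X = enum_sets b c.
Proof.
by split=> -[c]; [rewrite op_in_lam|move=> h; exists c; rewrite op_in_lam]; def; exists c.
Qed.

(** As long as something is fresh, each step adds a new subset of [assigns b], which
    [no_ord_injection] forbids from going on through all the ordinals. *)
Lemma enum_sets_stop b : exists a, ordinal a /\ ~ fresh b (lam a (enum_sets b)).
Proof.
have hE : pfun (enum_step b) by def.
have hE' : pfun (enum_sets b) by def.
apply: NNPP => hn; apply: (@no_ord_injection (enum_sets b) (pw (assigns b))) => // [a ha|a c ha hc].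
  by rewrite /enum_sets trans_recE //; apply/in_pw; apply: pick_sub.
have hf : fresh b (lam a (enum_sets b)) by apply: NNPP => h; apply: hn; exists a.
move=> h; apply: (enum_step_fresh hf); apply/old_enum_sets; exists c; split=> //.
by rewrite h {2}/enum_sets trans_recE.
Qed.

Section Closed.
Variables (b a : M).
Hypotheses (ha : ordinal a) (hstop : ~ fresh b (lam a (enum_sets b))).
Let f := lam a (enum_sets b).

Lemma closed d e : ordinal d -> ordinal e -> old f (pick b f d e).
Proof.
by move=> hd he; apply: NNPP => h; apply: hstop; exists d; split=> //; exists e.
Qed.

Lemma old_ap X : old f X -> exists c, ordinal c /\ X = ap f c.
Proof.
move=> /old_enum_sets [c [hc ->]]; exists c; split; first exact: ord_in hc.
by rewrite ap_lam //; def.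
Qed.

Lemma old_nand X Y : old f X -> old f Y -> old f (opNand b X Y).
Proof.
move=> /old_ap [c [hc ->]] /old_ap [d [hd ->]].
by have [_ [_ [h _]]] := pick_old (closed hc hd).
Qed.

Definition codes phi X : Prop := forall s, s ∈ X <->
  s ∈ assigns b /\ sat_in (fun y => y ∈ V b) phi (env s).

(** Induction on the external formula along the closure of the range of [f]; the numerals index the
    variables of atomic formulas, and [opNand] yields both negation and conjunction. *)
Lemma codes_exists phi : exists X, old f X /\ codes phi X.
Proof.
have hi i := ord_in (ord_omega M) (num_omega M i).
elim: phi => [i j|i j|p [X [hX hp]]|p [X [hX hp]] q [Y [hY hq]]|p [X [hX hp]]].
- have [h _] := pick_old (closed (hi i) (hi j)).
  by eexists; split; first exact: h; move=> s; rewrite in_sep; def.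
- have [_ [h _]] := pick_old (closed (hi i) (hi j)).
  by eexists; split; first exact: h; move=> s; rewrite in_sep; def.
- exists (opNand b X X); split; first exact: old_nand.
  by move=> s; rewrite in_sep /=; def; rewrite hp; tauto.
- exists (opNand b (opNand b X Y) (opNand b X Y)); split.
    by apply: old_nand; apply: old_nand.
  by move=> s; rewrite !in_sep /=; def; rewrite hp hq; tauto.
- have [c [hc hXc]] := old_ap hX; have [_ [_ [_ [h _]]]] := pick_old (closed hc hc).
  exists (opEx b X); split; first by rewrite hXc.
  move=> s; rewrite in_sep /=; def; split=> -[hs [x [hx h']]]; split=> //; exists x; split=> //.
    by move: h'; rewrite hp env_acons => -[].
  by rewrite hp env_acons; split=> //; apply: acons_Funs.
Qed.

(** Induction from the right end of the list: [opInst] puts [x] in front of the assignment, hence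
    right after the parameters already inserted. *)
Lemma inst_exists phi (l : list M) : Forall (fun x => ordinal x /\ x ∈ V b) l ->
  exists X, old f X /\ forall s, s ∈ X <->
    s ∈ assigns b /\ sat_in (fun y => y ∈ V b) phi (app_env l (env s)).
Proof.
elim/rev_ind: l => [|x l IH]; first by move=> _; apply: codes_exists.
move=> /Forall_app [/IH [X [hX h]]  hx]; have [hxo hxb] : ordinal x /\ x ∈ V b := Forall_inv hx.
have [c [hc hXc]] := old_ap hX; have [_ [_ [_ [_ h']]]] := pick_old (closed hc hxo).
exists (opInst b x X); split; first by rewrite hXc.
move=> s; rewrite in_sep; def; split=> -[hs h1]; split=> //.
  by move: h1; rewrite h env_acons app_env_app => -[].
by rewrite h env_acons; move: h1; rewrite app_env_app => ?; split=> //; apply: acons_Funs.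
Qed.
End Closed.

(** Evaluating at the constant assignment reads every variable left over as [z], in accordance with
    the convention in [OD]. *)
Definition decode b c : M := cpr (fun z => z ∈ V b /\ aconst z ∈ enum_sets b c).

Lemma dt_decode C t s : dt C t -> dt C s -> dt C (fun e => decode (t e) (s e)).
Proof. by apply: dt2; rewrite /decode; def. Qed.
#[local] Hint Resolve dt_decode : def.

(** An ordinal definable set is thus located by two ordinals, with no reference to an external
    formula, and can be selected by taking least ones. *)
Theorem OD_code x : OD x -> exists b, ordinal b /\ exists c, ordinal c /\ x = decode b c.
Proof.
move=> [phi [b [v [l [hb [hv [hl hx]]]]]]]; exists b; split=> //.
move/(stageE _ hb): hv => ?; subst v.
have [a [ha hstop]] := enum_sets_stop b.
(* Variable 0 goes to the first slot after the parameters, where the constant assignment has the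
   value [z], and parameter [i + 1] goes to slot [i]; all further variables already read [z]. *)
pose psi := ren (fun n => match n with 0 => length l | S i => if i <? length l then i else S i end) phi.
have [|X [/old_enum_sets [c [hc ->]] hX]] := inst_exists ha hstop psi (l := l).
  by apply/Forall_forall.
exists c; split; first exact: ord_in hc.
apply: set_ext => z; rewrite hx /decode in_sep; def.
have E : z ∈ V b -> aconst z ∈ enum_sets b c <->
   sat_in (fun y => y ∈ V b) phi (fun i => nth i (z :: l) z).
  move=> hz; rewrite hX env_aconst /psi sat_in_ren.
  suff -> : (fun n => app_env l (fun _ => z) match n with 0 => length l
      | S i => if i <? length l then i else S i end) = (fun i => nth i (z :: l) z).
    by split=> [[]|] //; split=> //; apply: aconst_Funs.
  apply: functional_extensionality => -[|i] /=; first by rewrite app_env_at.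
  case: Nat.ltb_spec => hi; first exact: app_env_nth.
  have -> : S i = length l + (S i - length l) by lia.
  by rewrite app_env_shift nth_overflow.
by split=> -[hz h]; split=> //; apply/(E hz).
Qed.

Lemma dfn_opair C t s u : dt C t -> dt C s -> dt C u ->
  dfn C (fun e => is_opair (t e : M) (s e) (u e)).
Proof.
move=> h1 h2 h3; apply: (dfn_ext (P := fun e => t e = op (s e) (u e))); first by def.
by move=> e; rewrite opairE.
Qed.
#[local] Hint Resolve dfn_opair : def.

Lemma dfn_wo C t s : dt C t -> dt C s -> dfn C (fun e => is_well_ordering (t e : M) (s e)).
Proof.
by apply: dfn2; rewrite /is_well_ordering /is_relation /well_orders /related; def.
Qed.
#[local] Hint Resolve dfn_wo : def.

(* Taking least codes makes [a |-> canon_wo a] definable without parameters. *)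
Definition canon_stage a : M :=
  least (fun b => exists c, ordinal c /\ is_well_ordering (decode b c) (pw a)).
Definition canon_wo a : M :=
  decode (canon_stage a) (least (fun c => is_well_ordering (decode (canon_stage a) c) (pw a))).

Lemma dt_canon_stage C t : dt C t -> dt C (fun e => canon_stage (t e)).
Proof. by apply: dt1; rewrite /canon_stage; def. Qed.
#[local] Hint Resolve dt_canon_stage : def.
Lemma dt_canon_wo C t : dt C t -> dt C (fun e => canon_wo (t e)).
Proof. by apply: dt1; rewrite /canon_wo; def. Qed.

Lemma powerE x p : is_power x p -> p = pw x.
Proof. by move=> h; apply: set_ext => z; rewrite in_pw. Qed.

Lemma canon_wo_spec a : (exists p r, is_power a p /\ is_well_ordering r p /\ OD r) ->
  is_well_ordering (canon_wo a) (pw a).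
Proof.
move=> [p [r [/powerE -> [hr /OD_code [b [hb [c [hc ?]]]]]]]]; subst r.
have [||_ [h _]] := @least_spec _ (fun b => exists c, ordinal c /\ is_well_ordering (decode b c) (pw a)).
  by def.
  by exists b; split=> //; exists c.
by have [|_ [h' _]] := @least_spec _ (fun c => is_well_ordering (decode (canon_stage a) c) (pw a)) _ h; def.
Qed.

End Enumeration.
#[export] Hint Resolve dfn_old dt_canon_wo dfn_opair dfn_wo : def.

(** * Well-orderings and choice inside the model *)

Section WellOrderings.
Variable M : zfc.
Implicit Types (x y z a b c d r X Y : M).

Section Facts.
Variables (r a : M).
Hypothesis hr : is_well_ordering r a.

Lemma wo_dom x y : op x y ∈ r -> x ∈ a /\ y ∈ a.
Proof.
case: hr => h _ /h [x' [y' [hx [hy /opairE /op_inj [-> ->]]]]] //.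
Qed.

Lemma wo_irr x : ~ op x x ∈ r.
Proof.
move=> h; have [hx _] := wo_dom h; case: hr => _ [h' _].
by apply: (h' _ hx); apply/relatedE.
Qed.

Lemma wo_trans x y z : op x y ∈ r -> op y z ∈ r -> op x z ∈ r.
Proof.
move=> h1 h2; have [hx hy] := wo_dom h1; have [_ hz] := wo_dom h2.
case: hr => _ [_ [h _]]; apply/relatedE; apply: (h x y z) => //; exact/relatedE.
Qed.

Lemma wo_total x y : x ∈ a -> y ∈ a -> op x y ∈ r \/ x = y \/ op y x ∈ r.
Proof.
by move=> hx hy; case: hr => _ [_ [_ [h _]]]; case: (h x y hx hy);
  [|case]; move=> h'; [left; apply/relatedE|right; left|right; right; apply/relatedE].
Qed.

Lemma wo_min b : subset b a -> (exists x, x ∈ b) ->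
  exists m, m ∈ b /\ forall x, x ∈ b -> m = x \/ op m x ∈ r.
Proof.
move=> hb hne; case: hr => _ [_ [_ [_ h]]]; have [m [hm h']] := h b hb hne.
exists m; split=> // x /h' [->|/relatedE]; auto.
Qed.
End Facts.

Lemma wo_intro r a : (forall p, p ∈ r -> exists x y, x ∈ a /\ y ∈ a /\ p = op x y) ->
  (forall x, x ∈ a -> ~ op x x ∈ r) ->
  (forall x y z, x ∈ a -> y ∈ a -> z ∈ a -> op x y ∈ r -> op y z ∈ r -> op x z ∈ r) ->
  (forall x y, x ∈ a -> y ∈ a -> op x y ∈ r \/ x = y \/ op y x ∈ r) ->
  (forall b, subset b a -> (exists x, x ∈ b) ->
     exists m, m ∈ b /\ forall x, x ∈ b -> m = x \/ op m x ∈ r) ->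
  is_well_ordering r a.
Proof.
move=> h1 h2 h3 h4 h5; split.
  by move=> p /h1 [x [y [hx [hy ->]]]]; exists x, y; rewrite opairE.
split; first by move=> x hx /relatedE; apply: h2.
split; first by move=> x y z hx hy hz /relatedE ? /relatedE ?; apply/relatedE; apply: (h3 x y z).
split=> [x y hx hy|b hb hne]; first by rewrite !relatedE; apply: h4.
have [m [hm h]] := h5 b hb hne; exists m; split=> // x /h.
by rewrite relatedE.
Qed.

Definition fst p : M := the (fun x => exists y, p = op x y).
Definition snd p : M := the (fun y => exists x, p = op x y).

Lemma fst_op x y : fst (op x y) = x.
Proof. by apply: the_eq => [|z [u /op_inj []]] //; exists y. Qed.
Lemma snd_op x y : snd (op x y) = y.
Proof. by apply: the_eq => [|z [u /op_inj []]] //; exists x. Qed.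

Lemma dt_fst C t : dt C t -> dt C (fun e => fst (t e)).
Proof. by apply: dt1; rewrite /fst; def. Qed.
Lemma dt_snd C t : dt C t -> dt C (fun e => snd (t e)).
Proof. by apply: dt1; rewrite /snd; def. Qed.

(** The axiom of choice is stated for disjoint families, so it is applied to the sets [A x] of pairs
    [op x y] with [y] admissible for [x]; distinct [x] give disjoint sets. *)
Lemma choice_function (R : M -> M -> Prop) X Y : dfn (@any M) (fun e => R (e 0) (e 1)) ->
  (forall x, x ∈ X -> exists y, y ∈ Y /\ R x y) ->
  exists c, forall x, x ∈ X -> ap c x ∈ Y /\ R x (ap c x).
Proof.
move=> hR h.
have hR1 x : pdef (fun y => R x y) by apply: (dfn2 (Q := R)); def.
have hR2 i j : dfn (@any M) (fun e => R (e i) (e j)) by apply: (dfn2 (Q := R)); def.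
pose A x := cpr (fun p => p ∈ prod X Y /\ exists y, R x y /\ p = op x y).
have hA : pfun A by rewrite /A; def.
have inA x p : p ∈ A x <-> p ∈ prod X Y /\ exists y, R x y /\ p = op x y.
  apply: (in_sep (P := fun p => exists y, R x y /\ p = op x y)).
  apply: dfn_ex; apply: dfn_and; [apply: (dfn2 (Q := R))|]; def.
pose F := cpr (fun y => exists x, x ∈ X /\ y = A x).
have inF y : y ∈ F <-> exists x, x ∈ X /\ y = A x by apply: in_image.
have opA x y : x ∈ X -> op x y ∈ A x <-> y ∈ Y /\ R x y.
  move=> hx; rewrite inA in_prod.
  split=> [[[x' [y' [_ [hy /op_inj [_ e1]]]]] [y2 [h2 /op_inj [_ e2]]]]|[hy hxy]].
    by split; [rewrite e1|rewrite e2].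
  by split; [exists x, y|exists y].
have [||c hc] := choice (zfc_axioms M) (a := F).
    move=> u /inF [x [hx ->]]; have [y [hy hxy]] := h x hx.
    by exists (op x y); apply/opA.
  move=> u v w /inF [x [hx ->]] /inF [y [hy ->]] /inA [_ [p [_ ->]]] /inA [_ [q [_ /op_inj [-> _]]]].
  by [].
(* The choice set may contain stray pairs outside the family; discarding them makes it functional on
   [X]. *)
pose c' := cpr (fun p => p ∈ c /\ exists x, x ∈ X /\ p ∈ A x).
have inc' p : p ∈ c' <-> p ∈ c /\ exists x, x ∈ X /\ p ∈ A x.
  apply: (in_sep (P := fun p => exists x, x ∈ X /\ p ∈ A x)).
  by apply: dfn_ex; apply: dfn_and; [|apply: dfn_mem; [|apply: (dt1 (F := A))]]; def.
exists c' => x hx.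
have [p [[hp hpc] hu]] := hc (A x) (proj2 (inF _) (ex_intro _ x (conj hx eq_refl))).
have [hpp [y [hxy ?]]] := proj1 (inA _ _) hp; subst p.
have [hy _] := proj1 (opA x y hx) hp.
suff -> : ap c' x = y by [].
apply: the_eq; first by apply/inc'; split=> //; exists x.
move=> z /inc' [hz [x' [hx' hz']]].
have ? : x = x' by case/inA: hz' => _ [y' [_ /op_inj [-> _]]].
subst x'; by have /op_inj [_ ->] := hu _ (conj hz' hz).
Qed.

End WellOrderings.
#[export] Hint Resolve dt_fst dt_snd : def.

(** * The ideal of sets avoiding a club of the singular cardinal *)

Section Ideal.
Variables (M : zfc) (K : M).
Implicit Types (x y z a b c d f g h : M).

(* Only monotone [h] are allowed: at a singular [K] the closure points of an
   arbitrary function may be bounded. *)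
Definition mono_fun h : Prop := h ∈ Funs K K /\
  forall b b', b ∈ K -> b' ∈ K -> subset b b' -> subset (ap h b) (ap h b').
Definition closed_point h a : Prop := (exists x, x ∈ a) /\ forall b, b ∈ a -> ap h b ∈ a.
Definition null (P : M -> Prop) : Prop :=
  exists h, mono_fun h /\ forall a, a ∈ K -> closed_point h a -> ~ P a.

Lemma dfn_mono_fun C t : C K -> dt C t -> dfn C (fun e => mono_fun (t e)).
Proof. by move=> hK; apply: dfn1; rewrite /mono_fun; def. Qed.
Lemma dfn_closed_point C t s : dt C t -> dt C s -> dfn C (fun e => closed_point (t e) (s e)).
Proof. by apply: dfn2; rewrite /closed_point; def. Qed.
#[local] Hint Resolve dfn_mono_fun dfn_closed_point : def.

Lemma dfn_null C (P : M -> (nat -> M) -> Prop) : C K ->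
  dfn C (fun e => P (e 0) (fun n => e (S n))) -> dfn C (fun e => null (fun x => P x e)).
Proof.
move=> hK hP; rewrite /null.
apply: (dfn_ex (P := fun h e => mono_fun h /\ forall a, a ∈ K -> closed_point h a -> ~ P a e)).
apply: dfn_and; first by def.
apply: (dfn_all (P := fun a e => a ∈ K -> closed_point (e 0) a -> ~ P a (fun n => e (S n)))).
have hP' := dfn_ren (up_ren S) hP.
by apply: dfn_imp; [def|apply: dfn_imp; [def|apply: dfn_not]].
Qed.

Lemma null_impl (P Q : M -> Prop) : null Q -> (forall a, a ∈ K -> P a -> Q a) -> null P.
Proof.
by move=> [h [hm hQ]] hPQ; exists h; split=> // a ha hc /(hPQ _ ha); apply: hQ.
Qed.

Lemma mono_fun_in h b : mono_fun h -> b ∈ K -> ap h b ∈ K.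
Proof. by move=> [/in_Funs [_ h'] _]; apply: h'. Qed.

Lemma mono_fun_lam (F : M -> M) : pfun F -> (forall b, b ∈ K -> F b ∈ K) ->
  (forall b b', b ∈ K -> b' ∈ K -> subset b b' -> subset (F b) (F b')) -> mono_fun (lam K F).
Proof.
move=> hF hK hm; split; first exact: lam_Funs.
by move=> b b' hb hb'; rewrite !ap_lam //; apply: hm.
Qed.

Lemma closed_point_lam (F : M -> M) a b : pfun F -> ordinal K -> a ∈ K ->
  closed_point (lam K F) a -> b ∈ a -> F b ∈ a.
Proof.
by move=> hF hK ha [_ h] hb; rewrite -(@ap_lam _ K F b hF (ord_trans hK ha hb)); apply: h.
Qed.

Hypothesis Kord : ordinal K.
Hypothesis Klim : forall a, a ∈ K -> succ a ∈ K.
Hypothesis Kne : exists a, a ∈ K.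
Hypothesis Kcof : forall F, pfun F -> (forall n, n ∈ omega -> F n ∈ K) ->
  exists c, c ∈ K /\ forall n, n ∈ omega -> F n ∈ c.

Lemma Kcup a b : a ∈ K -> b ∈ K -> cup a b ∈ K.
Proof.
move=> ha hb; case: (ord_le_total (ord_in Kord ha) (ord_in Kord hb)) => h.
  suff -> : cup a b = a by [].
  apply: set_ext => z; rewrite in_cup; split=> [[]|] //; last by left.
  exact: (ord_trans (ord_in Kord ha) h).
suff -> : cup a b = b by [].
by apply: set_ext => z; rewrite in_cup; split=> [[]|] //; [apply: h|right].
Qed.

(** The function sending [b] to the least [c] with [R b c] is monotone because [R] is inherited by
    smaller [b]. Its closure points form a club of points below which [R] can be witnessed. *)
Lemma mono_fun_least (R : M -> M -> Prop) : dfn (@any M) (fun e => R (e 0) (e 1)) ->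
  (forall b, b ∈ K -> exists c, c ∈ K /\ R b c) ->
  (forall b b' c, b ∈ K -> b' ∈ K -> subset b b' -> R b' c -> R b c) ->
  exists h, mono_fun h /\ forall a, a ∈ K -> closed_point h a ->
    forall b, b ∈ a -> exists c, c ∈ a /\ R b c.
Proof.
move=> hR hex hmon.
have hR1 b : pdef (R b) by apply: (dfn2 (Q := R)); def.
have hR2 i j : dfn (@any M) (fun e => R (e i) (e j)) by apply: (dfn2 (Q := R)); def.
pose F b := least (R b).
have hF : pfun F by rewrite /F; apply: (dt_least (P := fun c e => R (e 0) c)).
have hl b : b ∈ K -> F b ∈ K /\ R b (F b).
  move=> hb; have [c [hc hRc]] := hex b hb; have hco := ord_in Kord hc.
  have [h1 [h2 h3]] := least_le (hR1 b) hco hRc.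
  by split=> //; apply: (ord_le_mem Kord h3).
exists (lam K F); split.
  apply: mono_fun_lam => // [b /hl []|b b' hb hb' hbb'] //.
  have [h1 h2] := hl b' hb'.
  have [||_ [_ h]] // := @least_le _ (R b) (F b') (hR1 b); first exact: ord_in h1.
  exact: hmon h2.
move=> a ha hcl b hb; exists (F b); split; first exact: closed_point_lam hcl hb.
by have [] := hl b (ord_trans Kord ha hb).
Qed.

(** By [Kcof] the countably many iterates of [h] are bounded below [K], so their supremum is a
    closure point below [K]. *)
Lemma closed_exists h b0 : mono_fun h -> b0 ∈ K -> exists a, a ∈ K /\ b0 ∈ a /\ closed_point h a.
Proof.
move=> hm hb0.
have [||||s [hs [hsK [u [hu [huo [hbu hcl]]]]]]] :=
  @closure_point M (fun a => a ∈ K) (ap h) b0 _ (pfun_ap h) _ _ Klim Kcup _ (proj2 hm) hb0.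
  by def.
  by move=> a; apply: ord_in.
  by move=> a b; apply: ord_trans.
  by move=> a; apply: mono_fun_in.
have [c [hc hsc]] := Kcof hs hsK; exists u; split; last first.
  by split=> //; split; [exists b0|move=> b /hcl []].
apply: (ord_le_mem Kord _ hc) => // y /hu [n [hn hy]].
by apply: ord_trans (hsc n hn) hy; apply: ord_in hc.
Qed.

Lemma closed_both h h' : mono_fun h -> mono_fun h' -> exists h'', mono_fun h'' /\
  forall a, a ∈ K -> closed_point h'' a -> closed_point h a /\ closed_point h' a.
Proof.
move=> hm hm'.
have [|||h'' [hm'' hcl]] := @mono_fun_least (fun b c => subset (ap h b) c /\ subset (ap h' b) c).
  by def.
  move=> b hb; exists (cup (ap h b) (ap h' b)).
    by split; [apply: Kcup; apply: mono_fun_in|split=> z hz; apply/in_cup; auto].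
  move=> b b' c hb hb' hbb' [h1 h2]; split=> z hz; [apply: h1|apply: h2].
      exact: (proj2 hm) hz.
  exact: (proj2 hm') hz.
exists h''; split=> // a ha hc; have hao := ord_in Kord ha.
have E b : b ∈ a -> ap h b ∈ a /\ ap h' b ∈ a.
  move=> hb; have [c [hca [h1 h2]]] := hcl a ha hc b hb; have hbK := ord_trans Kord ha hb.
  split; [apply: (ord_le_mem hao h1 hca)|apply: (ord_le_mem hao h2 hca)];
  by apply: (ord_in Kord); apply: mono_fun_in.
by case: hc => hne _; split; split=> // b /E [].
Qed.

(** Countable completeness: for each [b] the values of the countably many functions at [b] have a
    common bound below [K], and the least such bound is monotone in [b]. *)
Lemma closed_all hs : (forall n, n ∈ omega -> mono_fun (ap hs n)) -> exists h, mono_fun h /\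
  forall a, a ∈ K -> closed_point h a -> forall n, n ∈ omega -> closed_point (ap hs n) a.
Proof.
move=> hm.
have [|||h [hm' hcl]] := @mono_fun_least (fun b c => forall n, n ∈ omega -> subset (ap (ap hs n) b) c).
  by def.
  move=> b hb; have [||c [hc hcn]] := @Kcof (fun n => ap (ap hs n) b); first by def.
      by move=> n hn; apply: mono_fun_in hb; apply: hm.
  by exists c; split=> // n hn; apply: ord_mem (ord_in Kord hc) (hcn n hn).
  move=> b b' c hb hb' hbb' h n hn z hz; apply: (h n hn).
    exact: (proj2 (hm n hn)) hz.
exists h; split=> // a ha hc n hn; split; first by case: hc.
move=> b hb; have [c [hca h1]] := hcl a ha hc b hb.
apply: (ord_le_mem (ord_in Kord ha) (h1 n hn) hca).
by apply: (ord_in Kord); apply: mono_fun_in; [apply: hm|apply: (ord_trans Kord ha)].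
Qed.

Lemma null_or (P Q : M -> Prop) : null P -> null Q -> null (fun a => P a \/ Q a).
Proof.
move=> [h [hm hP]] [h' [hm' hQ]]; have [h'' [hm'' hcl]] := closed_both hm hm'.
exists h''; split=> // a ha hc; have [h1 h2] := hcl a ha hc.
by case; [apply: hP|apply: hQ].
Qed.

(** The closure points of the constant function [b] are the points above [b], so a property with no
    instance above [b] is null. *)
Lemma not_null_unbounded (P : M -> Prop) b : ~ null P -> b ∈ K -> exists a, a ∈ K /\ b ∈ a /\ P a.
Proof.
move=> hP hb; apply: NNPP => hn; apply: hP.
exists (lam K (fun _ => b)); have hF : pfun (fun _ => b) by def.
split; first by apply: mono_fun_lam => // *; apply: subset_refl.
move=> a ha hcl hPa; apply: hn; exists a; split=> //; split=> //.
by case: (hcl) => -[x hx] _; apply: closed_point_lam hcl hx.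
Qed.

Lemma not_null_true : ~ null (fun _ => True).
Proof.
move=> [h [hm hn]]; have [b hb] := Kne; have [a [ha [_ hc]]] := closed_exists hm hb.
exact: hn ha hc I.
Qed.

End Ideal.
#[export] Hint Resolve dfn_mono_fun dfn_closed_point : def.
#[export] Hint Extern 1 (dfn _ (fun _ => null _ _)) => simple apply dfn_null; cbv beta : def.

(** * The rank of a function modulo the ideal *)

Section Rank.
Variables (M : zfc) (K : M).
Implicit Types (x y z a b c d f g h : M).

Definition power_funs : M := Funs K (pw K).
(** The order of functions modulo the null ideal restricted to [a]. When [canon_wo x] is a
    well-ordering of the power set of [x], the comparison also forces both values to be subsets of
    [x]. *)
Definition below_on a g f : Prop := null K (fun x => x ∈ a /\ ~ op (ap g x) (ap f x) ∈ canon_wo x).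
(** The recursion builds, for each [r], the table of all pairs of rank at least [r]. Working with
    lower bounds instead of values accommodates pairs without a rank, such as those with [a]
    null. *)
Definition rank_step t : M := cpr (fun p => exists f a, f ∈ power_funs /\ a ∈ pw K /\ p = op f a /\
  forall s x, op s x ∈ t -> exists g, g ∈ power_funs /\ below_on a g f /\ op g a ∈ x).
Definition rank_table r : M := trans_rec rank_step r.
(* [rank_ge r f a] says that the rank of [f] on [a] is at least [r]. *)
Definition rank_ge r f a : Prop := op f a ∈ rank_table r.

Lemma dt_power_funs C : C K -> dt C (fun _ => power_funs).
Proof. by move=> hK; rewrite /power_funs; def. Qed.
#[local] Hint Resolve dt_power_funs : def.
Lemma dfn_below_on C t s u : C K -> dt C t -> dt C s -> dt C u ->
  dfn C (fun e => below_on (t e) (s e) (u e)).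
Proof. by move=> hK; apply: dfn3; rewrite /below_on; def. Qed.
#[local] Hint Resolve dfn_below_on : def.
Lemma dt_rank_table C t : C K -> dt C t -> dt C (fun e => rank_table (t e)).
Proof. by move=> hK; apply: dt1; rewrite /rank_table /rank_step; def. Qed.
#[local] Hint Resolve dt_rank_table : def.
Lemma dfn_rank_ge C t s u : C K -> dt C t -> dt C s -> dt C u ->
  dfn C (fun e => rank_ge (t e) (s e) (u e)).
Proof. by move=> hK; apply: dfn3; rewrite /rank_ge; def. Qed.
#[local] Hint Resolve dfn_rank_ge : def.

Lemma rank_geE r f a : ordinal r -> rank_ge r f a <-> f ∈ power_funs /\ a ∈ pw K /\
  forall s, s ∈ r -> exists g, g ∈ power_funs /\ below_on a g f /\ rank_ge s g a.
Proof.
move=> hr; have hT : pfun rank_table by apply: dt_rank_table; def.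
have hS : pfun rank_step by rewrite /rank_step; def.
rewrite /rank_ge {1}/rank_table trans_recE // /rank_step in_cpr.
  apply: (small_sub (a := prod power_funs (pw K))); first by def.
  move=> p [f' [a' [hf [ha [-> _]]]]]; apply/in_prod; by exists f', a'.
split=> [[f' [a' [hf [ha [/op_inj [-> ->] h]]]]]|[hf [ha h]]].
  by split=> //; split=> // s hs; apply: (h s (rank_table s)); apply/op_in_lam.
exists f, a; split=> //; split=> //; split=> // s x /op_in_lam h'; have [//|hs ->] := h'.
exact: h.
Qed.

Hypothesis Kord : ordinal K.
Hypothesis Klim : forall a, a ∈ K -> succ a ∈ K.
Hypothesis Kne : exists a, a ∈ K.
Hypothesis Kcof : forall F, pfun F -> (forall n, n ∈ omega -> F n ∈ K) ->
  exists c, c ∈ K /\ forall n, n ∈ omega -> F n ∈ c.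
Hypothesis Kwo : forall a, a ∈ K -> is_well_ordering (canon_wo a) (pw a).

Lemma rank_ge_dom r f a : ordinal r -> rank_ge r f a -> f ∈ power_funs /\ a ∈ pw K.
Proof. by move=> hr /(rank_geE _ _ hr) [h1 [h2 _]]. Qed.

Lemma rank_ge_anti r s f a : ordinal r -> ordinal s -> subset s r -> rank_ge r f a -> rank_ge s f a.
Proof. by move=> hr hs hsr; rewrite !rank_geE // => -[h1 [h2 h3]]; auto. Qed.

Lemma below_on_sub a a' g f : subset a a' -> below_on a' g f -> below_on a g f.
Proof. by move=> ha h; apply: null_impl h _ => x _ [hx h']; split=> //; apply: ha. Qed.

Lemma rank_ge_sub r f a a' : ordinal r -> subset a a' -> rank_ge r f a' -> rank_ge r f a.
Proof.
move=> hr haa'; move: r hr f; apply: ord_ind; first by def.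
move=> r hr IH f; rewrite !rank_geE // => -[hf [ha h]]; split=> //; split.
  by apply/in_pw => z /haa'; move/in_pw: ha; apply.
move=> s hs; have [g [hg [hl hT]]] := h s hs; exists g; split=> //; split.
  exact: below_on_sub hl.
exact: IH.
Qed.

Lemma rank_ge_congr r f f' a : ordinal r -> f' ∈ power_funs ->
  (forall x, x ∈ a -> ap f x = ap f' x) ->
  rank_ge r f a -> rank_ge r f' a.
Proof.
move=> hr hf' he; rewrite !rank_geE // => -[hf [ha h]]; split=> //; split=> // s hs.
have [g [hg [hl hT]]] := h s hs; exists g; split=> //; split=> //.
by apply: null_impl hl _ => x _ [hx]; rewrite he.
Qed.

(** The witnesses for [a] and for [b] are glued, using the first on [a] and the second on the rest
    of [b]. This makes the sets of large rank closed under unions. *)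
Lemma rank_ge_cup r f a b : ordinal r -> rank_ge r f a -> rank_ge r f b -> rank_ge r f (cup a b).
Proof.
move=> hr; move: r hr f b; apply: ord_ind; first by def.
move=> r hr IH f b; rewrite !rank_geE // => -[hf [ha h1]] [_ [hb h2]]; split=> //; split.
  by apply/in_pw => z /in_cup [hz|hz]; [move/in_pw: ha|move/in_pw: hb]; apply.
move=> s hs; have hso := ord_in hr hs.
have [g1 [hg1 [hl1 hT1]]] := h1 s hs; have [g2 [hg2 [hl2 hT2]]] := h2 s hs.
pose G x := ite (x ∈ a) (ap g1 x) (ap g2 x).
have hG : pfun G by rewrite /G; def.
have hg : lam K G ∈ power_funs.
  apply: lam_Funs => // x hx; case: (classic (x ∈ a)) => hxa.
    by rewrite /G in_iteT //; case/in_Funs: hg1 => _; apply.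
  by rewrite /G in_iteF //; case/in_Funs: hg2 => _; apply.
have E1 x : x ∈ a -> ap (lam K G) x = ap g1 x.
  by move=> hx; rewrite ap_lam ?/G ?in_iteT //; move/in_pw: ha; apply.
have E2 x : x ∈ b -> ~ x ∈ a -> ap (lam K G) x = ap g2 x.
  by move=> hx hxa; rewrite ap_lam ?/G ?in_iteF //; move/in_pw: hb; apply.
pose b' := cpr (fun x => x ∈ b /\ ~ x ∈ a).
have hb' x : x ∈ b' <-> x ∈ b /\ ~ x ∈ a by apply: (in_sep (P := fun x => ~ x ∈ a)); def.
exists (lam K G); split=> //; split.
  apply: null_impl (null_or Kord hl1 hl2) _ => x hx [/in_cup hxab hn].
  case: (classic (x ∈ a)) => hxa; first by left; rewrite -E1.
  by right; case: hxab => // hxb; rewrite -E2.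
have -> : cup a b = cup a b'.
  apply: set_ext => z; rewrite !in_cup hb'; case: (classic (z ∈ a)); tauto.
apply: IH => //.
  by apply: rank_ge_congr hT1 => // x /E1.
apply: (rank_ge_congr (f := g2)) => //; first by move=> x /hb' [h3 h4]; rewrite E2.
by apply: rank_ge_sub hT2 => // x /hb' [].
Qed.

(** On a null set every function is below every other one, so [f] is its own witness at each
    stage. *)
Lemma rank_ge_null r f a : ordinal r -> f ∈ power_funs -> a ∈ pw K ->
  null K (fun x => x ∈ a) -> rank_ge r f a.
Proof.
move=> hr hf ha hn; move: r hr; apply: ord_ind; first by def.
move=> r hr IH; apply/rank_geE => //; split=> //; split=> // s hs; exists f; split=> //.
split; last exact: IH.
by apply: null_impl hn _ => x _ [].
Qed.

Lemma rank_ge_mod r f a a' : ordinal r -> a' ∈ pw K -> null K (fun x => x ∈ a' /\ ~ x ∈ a) ->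
  rank_ge r f a -> rank_ge r f a'.
Proof.
move=> hr ha' hn hT; have [hf ha] := rank_ge_dom hr hT.
pose b := cpr (fun x => x ∈ a' /\ ~ x ∈ a).
have hb x : x ∈ b <-> x ∈ a' /\ ~ x ∈ a by apply: (in_sep (P := fun x => ~ x ∈ a)); def.
have hTb : rank_ge r f b.
  apply: rank_ge_null => //; last by apply: null_impl hn _ => x _ /hb.
  by apply/in_pw => x /hb [hx _]; move/in_pw: ha'; apply.
apply: rank_ge_sub (rank_ge_cup hr hT hTb) => // x hx; apply/in_cup.
by case: (classic (x ∈ a)) => h; [left|right; apply/hb].
Qed.

Definition unranked a g : Prop := g ∈ power_funs /\ forall r, ordinal r -> rank_ge r g a.

(** Otherwise every function below [g] has a rank on [a]. Let [s] bound the failures [R g'] of all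
    ranked functions; rank at least [s + 1] for [g] then asks for one of them to have rank at least
    [s], which is impossible. *)
Lemma unranked_step a g : unranked a g -> exists g', unranked a g' /\ below_on a g' g.
Proof.
move=> [hg hT]; apply: NNPP => hn.
pose R g' := least (fun r => ~ rank_ge r g' a).
have hR : pfun R by rewrite /R; def.
have hd g' : pdef (fun r => ~ rank_ge r g' a) by def.
pose d := cpr (fun g' => g' ∈ power_funs /\ ~ unranked a g').
have hdd g' : g' ∈ d <-> g' ∈ power_funs /\ ~ unranked a g'.
  by apply: (in_sep (P := fun g => ~ unranked a g)); rewrite /unranked; def.
have hRs g' : g' ∈ d -> ordinal (R g') /\ ~ rank_ge (R g') g' a.
  move=> /hdd [hg' hu]; have [|h1 [h2 _]] := @least_spec M (fun r => ~ rank_ge r g' a) (hd g').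
    apply: NNPP => h; apply: hu; split=> // r hr; apply: NNPP => h'; apply: h.
    by exists r.
  by [].
pose s := Un (cpr (fun y => exists g', g' ∈ d /\ y = R g')).
have hs : ordinal s by apply: ord_bigcup => // g' /hRs [].
have := hT (succ s) (ord_succ hs); rewrite rank_geE; first exact: ord_succ.
move=> [_ [_ h]]; have [g' [hg' [hl hT']]] := h s (mem_succ s).
have hgd : g' ∈ d by apply/hdd; split=> // hu; apply: hn; exists g'.
have [h1 h2] := hRs g' hgd; apply: h2; apply: rank_ge_anti hT' => // z hz.
by apply/in_bigcup => //; exists g'.
Qed.

(* Countable completeness of the ideal turns a descending sequence of
   functions into a descending sequence at one point. *)
Lemma rank_ge_bounded f a : f ∈ power_funs -> ~ null K (fun x => x ∈ a) ->
  exists r, ordinal r /\ ~ rank_ge r f a.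
Proof.
move=> hf ha; apply: NNPP => hn.
have hu0 : unranked a f.
  by split=> // r hr; apply: NNPP => h; apply: hn; exists r.
pose B := cpr (fun g => g ∈ power_funs /\ unranked a g).
have hud : pdef (unranked a) by rewrite /unranked; def.
have hB g : g ∈ B <-> unranked a g.
  by rewrite (in_sep _ _ hud); split=> [[]|h] //; split=> //; case: h.
(* With each smaller function the choice also returns a function [h] whose closure points witness
   the comparison, so that the countably many clubs can be intersected at once. *)
pose R g p := exists g' h, p = op g' h /\ mono_fun K h /\ forall x, x ∈ K -> closed_point h x ->
   x ∈ a -> op (ap g' x) (ap g x) ∈ canon_wo x.
have hRd : dfn (@any M) (fun e => R (e 0) (e 1)) by rewrite /R; def.
have [|c hc] := choice_function (X := B) (Y := prod B (Funs K K)) hRd.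
  move=> g /hB /unranked_step [g' [hg' [h [hm hcl]]]]; exists (op g' h); split.
    by apply/in_prod; exists g', h; rewrite hB; case: hm.
  exists g', h; split=> //; split=> // x hx hxc hxa; apply: NNPP => hno.
  by apply: (hcl x hx hxc).
pose F g := fst (ap c g).
have hF : pfun F by rewrite /F; def.
pose s := iter F f.
have hs : pfun s := pfun_iter f hF.
have sB n : n ∈ omega -> s n ∈ B.
  move: n; apply: omega_ind; first by apply: dfn_mem; def; apply: (dt1 (F := s)); def.
    by rewrite /s iter0 //; apply/hB.
  move=> n hn' hsn; rewrite /s iterS // /F.
  have [/in_prod [g [h [hg [_ ->]]]] _] := hc _ hsn; by rewrite fst_op.
pose hs' := lam omega (fun n => snd (ap c (s n))).
have hpf : pfun (fun n => snd (ap c (s n))).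
  by apply: dt_snd; apply: dt_ap; [def|apply: (dt1 (F := s)); def].
have step n : n ∈ omega -> mono_fun K (ap hs' n) /\ forall x, x ∈ K -> closed_point (ap hs' n) x ->
   x ∈ a -> op (ap (s (succ n)) x) (ap (s n) x) ∈ canon_wo x.
  move=> hn'; have -> : s (succ n) = F (s n) by rewrite /s iterS.
  rewrite ap_lam // /F.
  have [_ [g' [h [-> [hm hx]]]]] := hc _ (sB n hn').
  by rewrite fst_op snd_op.
have [|h [hm hcl]] := @closed_all M K Kord Kcof hs'; first by move=> n /step [].
apply: ha; exists h; split=> // x hx hcx hxa.
have hdec n : n ∈ omega -> op (ap (s (succ n)) x) (ap (s n) x) ∈ canon_wo x.
  by move=> hn'; apply: (proj2 (step n hn')) => //; apply: hcl.
have hq : pfun (fun n => ap (s n) x).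
  by apply: dt_ap; [apply: (dt1 (F := s))|]; def.
(* At this single point [x] the values [s n] descend strictly in [canon_wo x], so their set can have
   no least element. *)
have hwo := Kwo hx.
have inD y := @in_image M (fun n => ap (s n) x) omega y hq.
have [||m [/inD [n [hn' ->]] hmin]] := wo_min hwo (b := cpr (fun y => exists n, n ∈ omega /\ y = ap (s n) x)).
    by move=> y /inD [n [hn' ->]]; case: (wo_dom hwo (hdec n hn')).
  by exists (ap (s emp) x); apply/inD; exists emp; split=> //; apply: omega_emp.
have := hdec n hn'; case: (hmin (ap (s (succ n)) x)).
    by apply/inD; exists (succ n); split=> //; apply: omega_succ.
  by move=> <-; apply: (wo_irr hwo).
by move=> h1 h2; apply: (wo_irr hwo (wo_trans hwo h1 h2)).
Qed.

(* [high_on A] is the ideal [J] and [trace_rank A] the successor of [rho]. *)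
Definition trace A : M := lam K (fun x => cpr (fun z => z ∈ A /\ z ∈ x)).
Definition trace_rank A : M := least (fun r => ~ rank_ge r (trace A) K).
Definition high_on A a : Prop := rank_ge (trace_rank A) (trace A) a.

Lemma dt_trace C t : C K -> dt C t -> dt C (fun e => trace (t e)).
Proof. by move=> hK; apply: dt1; rewrite /trace; def. Qed.
#[local] Hint Resolve dt_trace : def.
Lemma dt_trace_rank C t : C K -> dt C t -> dt C (fun e => trace_rank (t e)).
Proof. by move=> hK; apply: dt1; rewrite /trace_rank; def. Qed.
#[local] Hint Resolve dt_trace_rank : def.

Lemma in_cap x y z : z ∈ cpr (fun z => z ∈ x /\ z ∈ y) <-> z ∈ x /\ z ∈ y.
Proof. by apply: (in_sep (P := fun z => z ∈ y)); def. Qed.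

Lemma ap_trace A x : x ∈ K -> ap (trace A) x = cpr (fun z => z ∈ A /\ z ∈ x).
Proof. by move=> hx; rewrite ap_lam; def. Qed.

Lemma trace_power_funs A : subset A K -> trace A ∈ power_funs.
Proof. by move=> hA; apply: lam_Funs => [|x hx]; def; apply/in_pw => z /in_cap [/hA]. Qed.

Lemma trace_rank_spec A : subset A K -> ordinal (trace_rank A) /\ ~ rank_ge (trace_rank A) (trace A) K /\
  forall r, r ∈ trace_rank A -> rank_ge r (trace A) K.
Proof.
move=> hA; have [||h1 [h2 h3]] := @least_spec M (fun r => ~ rank_ge r (trace A) K).
- by def.
- apply: rank_ge_bounded; first exact: trace_power_funs.
  by move=> h; apply: (not_null_true Kord Klim Kne Kcof); apply: null_impl h _.
- by split=> //; split=> // r /h3 /NNPP.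
Qed.

(* The function [trace A] itself witnesses that the rank of [trace B] on [a] is
   at least [trace_rank B]. *)
Lemma high_on_less A B a : subset A K -> subset B K -> trace_rank A = trace_rank B -> a ∈ pw K ->
  (forall x, x ∈ a -> op (ap (trace A) x) (ap (trace B) x) ∈ canon_wo x) -> high_on B a.
Proof.
move=> hA hB hrk ha h; have [hr [_ hlow]] := trace_rank_spec hA.
rewrite /high_on -hrk; apply/rank_geE => //; split; first exact: trace_power_funs.
split=> // s hs; exists (trace A); split; first exact: trace_power_funs.
have hso := ord_in hr hs; split.
  have [b hb] := Kne; exists (lam K (fun x => x)).
  split; first by apply: mono_fun_lam; def.
  by move=> x hx _ [/h].
by apply: rank_ge_sub (hlow s hs) => //; apply/in_pw.
Qed.

(** The sets [L A B] and [L B A], where one trace precedes the other, both belong to the common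
    ideal, hence so does their union; the traces must then agree often enough to determine the
    sets. *)
Theorem invariants_injective A B : subset A K -> subset B K -> trace_rank A = trace_rank B ->
  (forall a, a ∈ pw K -> high_on A a <-> high_on B a) -> A = B.
Proof.
move=> hA hB hrk hJ.
pose L A B := cpr (fun x => x ∈ K /\ op (ap (trace A) x) (ap (trace B) x) ∈ canon_wo x).
have inL A' B' x : x ∈ L A' B' <-> x ∈ K /\ op (ap (trace A') x) (ap (trace B') x) ∈ canon_wo x.
  by apply: (in_sep (P := fun x => op (ap (trace A') x) (ap (trace B') x) ∈ canon_wo x)); def.
have LK A' B' : L A' B' ∈ pw K by apply/in_pw => x /inL [].
have h1 : high_on A (L A B).
  by apply/hJ => //; apply: (high_on_less hA hB) => // x /inL [].
have h2 : high_on A (L B A) by apply: (high_on_less hB hA) => // x /inL [].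
have [hr [hK _]] := trace_rank_spec hA.
have hJc := rank_ge_cup hr h1 h2.
(* If the traces agreed only on a null set, the union of [L A B] and [L B A] would be all of [K] up
   to a null set, and the rank on [K] would reach [trace_rank K A]. *)
have hnn : ~ null K (fun x => ap (trace A) x = ap (trace B) x).
  move=> hn; apply: hK; apply: rank_ge_mod hJc => //; first by apply/in_pw; apply: subset_refl.
  apply: null_impl hn _ => x hx [_ hxn]; apply: NNPP => hne; apply: hxn; apply/in_cup.
  have hin C' : ap (trace C') x ∈ pw x by rewrite ap_trace //; apply/in_pw => z /in_cap [].
  case: (wo_total (Kwo hx) (hin A) (hin B)) => [h|[|h]] //.
    by left; apply/inL.
  by right; apply/inL.
suff hs A' B' : subset A' K -> (forall x, ap (trace A') x = ap (trace B') x <-> ap (trace A) x = ap (trace B) x) ->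
    subset A' B'.
  by apply: set_ext => z; split; apply: hs => // x; split.
(* Points of agreement are unbounded in [K], so one of them lies above [z] and decides the
   membership of [z] in both sets. *)
move=> hA' hAB z hz; have [x [hx [hzx /hAB e]]] := not_null_unbounded Kord hnn (hA' z hz).
have : z ∈ ap (trace A') x by rewrite ap_trace //; apply/in_cap.
by rewrite e ap_trace // => /in_cap [].
Qed.

End Rank.
#[export] Hint Resolve dt_power_funs dfn_below_on dt_rank_table dfn_rank_ge dt_trace dt_trace_rank : def.

(** * Coding the invariants by subsets of the cofinality *)

Section Codes.
Variables (M : zfc) (K L : M).
Implicit Types (x y z a b c d f g h A B : M).

Definition cofinal_in g : Prop := (forall i, i ∈ L -> ap g i ∈ K) /\
  forall a, a ∈ K -> exists i, i ∈ L /\ subset a (ap g i).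
(* The supremum of the stages at which [g] is still bounded below [x].  Unlike the
   least [i] with [x <= g i], it is independent of [g] at club many [x] even when
   [g] is neither monotone nor continuous. *)
Definition level g x : M :=
  cpr (fun i => i ∈ L /\ exists b, b ∈ x /\ forall j, j ∈ succ i -> ap g j ∈ b).
Definition level_preim g Y : M := cpr (fun x => x ∈ K /\ level g x ∈ Y).
Definition code A Y : Prop := exists g, cofinal_in g /\ high_on K A (level_preim g Y).

Lemma dfn_high_on C t s : C K -> dt C t -> dt C s -> dfn C (fun e => high_on K (t e) (s e)).
Proof. by move=> hK; apply: dfn2; rewrite /high_on; def. Qed.
#[local] Hint Resolve dfn_high_on : def.
Lemma dfn_cofinal_in C t : C K -> C L -> dt C t -> dfn C (fun e => cofinal_in (t e)).
Proof. by move=> hK hL; apply: dfn1; rewrite /cofinal_in; def. Qed.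
#[local] Hint Resolve dfn_cofinal_in : def.
Lemma dt_level C t s : C L -> dt C t -> dt C s -> dt C (fun e => level (t e) (s e)).
Proof. by move=> hL; apply: dt2; rewrite /level; def. Qed.
#[local] Hint Resolve dt_level : def.
Lemma dt_level_preim C t s : C K -> C L -> dt C t -> dt C s ->
  dt C (fun e => level_preim (t e) (s e)).
Proof. by move=> hK hL; apply: dt2; rewrite /level_preim; def. Qed.
#[local] Hint Resolve dt_level_preim : def.
Lemma dfn_code C t s : C K -> C L -> dt C t -> dt C s -> dfn C (fun e => code (t e) (s e)).
Proof. by move=> hK hL; apply: dfn2; rewrite /code; def. Qed.

Lemma in_level g x i : i ∈ level g x <-> i ∈ L /\ exists b, b ∈ x /\ forall j, j ∈ succ i -> ap g j ∈ b.
Proof.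
apply: (in_sep (P := fun i => exists b, b ∈ x /\ forall j, j ∈ succ i -> ap g j ∈ b)); def.
Qed.

Lemma in_level_preim g Y x : x ∈ level_preim g Y <-> x ∈ K /\ level g x ∈ Y.
Proof. by apply: (in_sep (P := fun x => level g x ∈ Y)); def. Qed.

Hypothesis Kord : ordinal K.
Hypothesis Lord : ordinal L.
Hypothesis Lom : omega ∈ L.
Hypothesis Klim : forall a, a ∈ K -> succ a ∈ K.
Hypothesis Kne : exists a, a ∈ K.
Hypothesis Kcof : forall i F, i ∈ L -> pfun F -> (forall j, j ∈ i -> F j ∈ K) ->
  exists c, c ∈ K /\ forall j, j ∈ i -> F j ∈ c.
Hypothesis Kwo : forall a, a ∈ K -> is_well_ordering (canon_wo a) (pw a).
Hypothesis CMex : exists g, cofinal_in g.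

(** A stage [i] with [x] included in [g i] bounds the level: a member [j] at or above [i] would put
    [g i] below some [b] in [x], hence below itself. *)
Lemma level_mem g x : cofinal_in g -> x ∈ K -> level g x ∈ L.
Proof.
move=> [_ hc] hx; have [i [hi hxi]] := hc x hx.
have hqi j : j ∈ level g x -> j ∈ i.
  move=> /in_level [hj [b [hb h]]].
  case: (ord_le_total (ord_in Lord hi) (ord_in Lord hj)) => // hij.
  have hij' : i ∈ succ j.
    by apply/in_succ; apply: ord_sub => //; apply: ord_in Lord _.
  by case: (mem_asym (h i hij')); apply: hxi.
apply: (ord_le_mem Lord (b := i)) => //.
apply: ordinal_intro => j /in_level [hj [b [hb h]]]; first exact: ord_in hj.
move=> k hk; apply/in_level; split; first exact: ord_trans hk.
exists b; split=> // l hl; apply: h; have hjo := ord_in Lord hj.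
by apply: ord_trans hl; [apply: ord_succ|apply: succ_mono].
Qed.

(** The stages [j] up to which [g] stays below [b] are bounded in [L], so the values of [g'] there
    are bounded below [K]. At a point closed under this bound, a stage up to which [g] is bounded
    below [x] is one up to which [g'] is too. *)
Lemma level_sub_null g g' : cofinal_in g -> cofinal_in g' ->
  null K (fun x => ~ subset (level g x) (level g' x)).
Proof.
move=> [_ hc] [hg' _].
have [|||h [hm hcl]] := @mono_fun_least M K Kord (fun b c => forall j, j ∈ L ->
   (forall i, i ∈ succ j -> ap g i ∈ b) -> ap g' j ∈ c).
    by def.
    move=> b hb; have [i [hi hbi]] := hc b hb.
    have [||c [hcK hcj]] := @Kcof i (ap g') hi; first by def.
      by move=> j hj; apply: hg'; apply: ord_trans hj.
    exists c; split=> // j hj hjb; apply: hcj.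
    case: (ord_le_total (ord_in Lord hi) (ord_in Lord hj)) => // hij.
    have hij' : i ∈ succ j.
      by apply/in_succ; apply: ord_sub => //; apply: ord_in Lord _.
    by case: (@mem_irrefl _ (ap g i)); apply: hbi; apply: hjb.
  by move=> b b' c hb hb' hbb' h j hj hi; apply: h => // i /hi; apply: hbb'.
exists h; split=> // x hx hxc; apply; move=> i /in_level [hi [b [hb hbi]]].
have [c [hcx hcj]] := hcl x hx hxc b hb.
apply/in_level; split=> //; exists c; split=> // j hj; have hio := ord_in Lord hi.
apply: hcj.
  by case/in_succ: hj => [hj|->] //; apply: ord_trans hj.
move=> k hk; apply: hbi; case/in_succ: hj => [hj|hj]; last by rewrite -hj.
by apply: ord_trans hk; [apply: ord_succ|apply: succ_mono].
Qed.

(* Hence the choice of [g] in [code] is immaterial. *)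
Lemma level_agree g g' : cofinal_in g -> cofinal_in g' -> null K (fun x => level g x <> level g' x).
Proof.
move=> h1 h2; apply: null_impl (null_or Kord (level_sub_null h1 h2) (level_sub_null h2 h1)) _ => x hx hne.
apply: NNPP => hn; apply: hne; apply: set_ext => i; split=> hi; apply: NNPP => h; apply: hn.
  by left=> h'; apply/h/h'.
by right=> h'; apply/h/h'.
Qed.

(** At a point [y] closed under [h], each [x] in [y] is passed by some [g i] while the values up to
    [i] remain bounded below [y]. Such an [i] is in the level of [y] but not in that of [x]. *)
Lemma level_inj g : cofinal_in g -> exists h, mono_fun K h /\ forall x y, x ∈ K -> y ∈ K ->
  closed_point h x -> closed_point h y -> level g x = level g y -> x = y.
Proof.
move=> [hg hc].
have [|||h [hm hcl]] := @mono_fun_least M K Kord (fun b c => exists i, i ∈ L /\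
   subset b (ap g i) /\ forall j, j ∈ succ i -> ap g j ∈ c).
    by def.
    move=> b hb; have [i [hi hbi]] := hc b hb.
    have [||c [hcK hcj]] := @Kcof i (ap g) hi; first by def.
      by move=> j hj; apply: hg; apply: ord_trans hj.
    exists (cup c (succ (ap g i))); split.
      by apply: Kcup => //; apply: Klim; apply: hg.
    exists i; split=> //; split=> // j /in_succ [/hcj hj|->]; apply/in_cup; first by left.
    by right; apply: mem_succ.
  by move=> b b' c hb hb' hbb' [i [hi [h1 h2]]]; exists i; split=> //; split=> // z /hbb' /h1.
exists h; split=> //.
have E x y : x ∈ K -> y ∈ K -> closed_point h y -> level g x = level g y -> ~ x ∈ y.
  move=> hx hy hyc he hxy; have [c [hcy [i [hi [h1 h2]]]]] := hcl y hy hyc x hxy.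
  have : i ∈ level g x by rewrite he; apply/in_level; split=> //; exists c.
  move=> /in_level [_ [b [hb hbi]]]; apply: (mem_asym (hbi i (mem_succ i))).
  exact: h1.
move=> x y hx hy hxc hyc he.
case: (ord_tri (ord_in Kord hx) (ord_in Kord hy)) => [hxy|[|hxy]] //.
  by case: (E x y hx hy hyc he).
by case: (E y x hy hx hxc).
Qed.

Lemma Kcof_omega F : pfun F -> (forall n, n ∈ omega -> F n ∈ K) ->
  exists c, c ∈ K /\ forall n, n ∈ omega -> F n ∈ c.
Proof. exact: Kcof. Qed.

(** Up to a null set, every [a] is the preimage of a set of levels, so the ideal is recovered from
    its trace on such preimages, which is what [code] records. *)
Theorem code_determines A B a : subset A K -> subset B K ->
  (forall Y, subset Y L -> code A Y <-> code B Y) -> a ∈ pw K -> high_on K A a -> high_on K B a.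
Proof.
move=> hA hB hc ha hJ; have [g hg] := CMex; have [h [hm hinj]] := level_inj hg.
have [hrA _] := trace_rank_spec Kord Klim Kne Kcof_omega Kwo hA.
have [hrB _] := trace_rank_spec Kord Klim Kne Kcof_omega Kwo hB.
have haK x : x ∈ a -> x ∈ K by move/in_pw: ha; apply.
(* Only levels of closure points of [h] are kept: there [level g] is injective, so the preimage of
   [Y] has no new point on the club. *)
pose Y := cpr (fun i => i ∈ L /\ exists x, x ∈ a /\ closed_point h x /\ i = level g x).
have hY i : i ∈ Y <-> i ∈ L /\ exists x, x ∈ a /\ closed_point h x /\ i = level g x.
  by apply: (in_sep (P := fun i => exists x, x ∈ a /\ closed_point h x /\ i = level g x)); def.
have preK g' : level_preim g' Y ∈ pw K by apply/in_pw => x /in_level_preim [].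
have : code A Y.
  exists g; split=> //; apply: rank_ge_mod hJ => //.
  exists h; split=> // x hx hxc [/in_level_preim [_ /hY [_ [y [hy [hyc he]]]]] hxa]; apply: hxa.
  by rewrite (hinj x y) //; apply: haK.
rewrite hc; first by move=> i /hY [].
move=> [g' [hg' hJ']]; apply: rank_ge_mod hJ' => //.
have hn : null K (fun x => ~ closed_point h x) by exists h; split=> // x _ ? [].
apply: null_impl (null_or Kord hn (level_agree hg hg')) _ => x hx [hxa hxp].
apply: NNPP => hno; apply: hxp; apply/in_level_preim; split=> //.
have hxc : closed_point h x by apply: NNPP => h'; apply: hno; left.
have <- : level g x = level g' x by apply: NNPP => h'; apply: hno; right.
by apply/hY; split; [apply: level_mem|exists x].
Qed.

End Codes.
#[export] Hint Resolve dfn_high_on dfn_cofinal_in dt_level dt_level_preim dfn_code : def.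

(** * Enumerating the subsets of the cofinality *)

Section Enumerate.
Variables (M : zfc) (L : M).
Implicit Types (x y z a b c d f g : M).

(** The recursion lists the power set of [L] in increasing order of [canon_wo L]; [pow_type] is the
    length of the list, the ordinal theta. *)
Definition pow_enum_step f : M := the (fun y => y ∈ pw L /\ ~ old f y /\
  forall z, z ∈ pw L -> ~ old f z -> y = z \/ op y z ∈ canon_wo L).
Definition pow_enum b : M := trans_rec pow_enum_step b.
Definition pow_type : M := least (fun b => forall y, y ∈ pw L -> old (lam b pow_enum) y).

Lemma dt_pow_enum_step C t : C L -> dt C t -> dt C (fun e => pow_enum_step (t e)).
Proof. by move=> hL; apply: dt1; rewrite /pow_enum_step; def. Qed.
#[local] Hint Resolve dt_pow_enum_step : def.
Lemma dt_pow_enum C t : C L -> dt C t -> dt C (fun e => pow_enum (t e)).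
Proof. by move=> hL; apply: dt1; rewrite /pow_enum; def. Qed.
#[local] Hint Resolve dt_pow_enum : def.
Lemma dt_pow_type C : C L -> dt C (fun _ => pow_type).
Proof. by move=> hL; rewrite /pow_type; def. Qed.

Hypothesis hwo : is_well_ordering (canon_wo L) (pw L).

Lemma old_pow_enum b y : old (lam b pow_enum) y <-> exists c, c ∈ b /\ y = pow_enum c.
Proof.
have ht : pfun pow_enum by def.
by split=> -[c]; [move=> /op_in_lam h; exists c; apply: h|
  move=> h; exists c; apply/op_in_lam].
Qed.

Lemma pow_enum_spec b : ordinal b -> (exists y, y ∈ pw L /\ ~ old (lam b pow_enum) y) ->
  pow_enum b ∈ pw L /\ ~ old (lam b pow_enum) (pow_enum b).
Proof.
move=> hb [y [hy hyo]]; have ht : pfun pow_enum_step by def.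
rewrite {1 3}/pow_enum trans_recE // -/pow_enum.
have hd : pdef (fun y => ~ old (lam b pow_enum) y) by def.
have inD z : z ∈ cpr (fun z => z ∈ pw L /\ ~ old (lam b pow_enum) z) <->
   z ∈ pw L /\ ~ old (lam b pow_enum) z := in_sep _ _ hd.
have [||m [/inD [hm1 hm2] hm3]] := wo_min hwo (b := cpr (fun z => z ∈ pw L /\ ~ old (lam b pow_enum) z)).
    by move=> z /inD [].
  by exists y; apply/inD.
have [||h1 [h2 _]] // := @the_spec M (fun y => y ∈ pw L /\ ~ old (lam b pow_enum) y /\
  forall z, z ∈ pw L -> ~ old (lam b pow_enum) z -> y = z \/ op y z ∈ canon_wo L).
  by exists m; split=> //; split=> // z hz hzo; apply: hm3; apply/inD.
move=> u v [hu1 [hu2 hu3]] [hv1 [hv2 hv3]].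
case: (hu3 v hv1 hv2) => // huv; case: (hv3 u hu1 hu2) => // hvu.
by case: (wo_irr hwo (wo_trans hwo huv hvu)).
Qed.

(** The listing must exhaust the power set, since otherwise it would inject all the ordinals into
    [pw L]; before exhaustion each value is new. *)
Lemma pow_type_spec : ordinal pow_type /\
  (forall y, y ∈ pw L -> exists b, b ∈ pow_type /\ y = pow_enum b) /\
  (forall b, b ∈ pow_type -> pow_enum b ∈ pw L) /\
  (forall b c, b ∈ pow_type -> c ∈ pow_type -> pow_enum b = pow_enum c -> b = c).
Proof.
have ht : pfun pow_enum by def.
have [||h1 [h2 h3]] := @least_spec M (fun b => forall y, y ∈ pw L -> old (lam b pow_enum) y); first by def.
  apply: NNPP => hn.
  have hne b : ordinal b -> exists y, y ∈ pw L /\ ~ old (lam b pow_enum) y.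
    move=> hb; apply: NNPP => h; apply: hn; exists b; split=> // y hy.
    by apply: NNPP => h'; apply: h; exists y.
  apply: (@no_ord_injection M pow_enum (pw L)) => // [b hb|b c hb hc he].
    by case: (pow_enum_spec hb (hne b hb)).
  by case: (pow_enum_spec hb (hne b hb)) => _; apply; apply/old_pow_enum; exists c.
rewrite -/pow_type in h1 h2 h3.
have hne b : b ∈ pow_type -> pow_enum b ∈ pw L /\ ~ old (lam b pow_enum) (pow_enum b).
  move=> hb; apply: pow_enum_spec; first exact: ord_in hb.
  apply: NNPP => h; apply: (h3 b hb) => y hy.
  by apply: NNPP => h'; apply: h; exists y.
split=> //; split; first by move=> y /h2 /old_pow_enum.
split; first by move=> b /hne [].
have E b c : b ∈ pow_type -> pow_enum b = pow_enum c -> ~ c ∈ b.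
  by move=> hb he hcb; case: (hne b hb) => _; apply; apply/old_pow_enum; exists c.
move=> b c hb hc he; case: (ord_tri (ord_in h1 hb) (ord_in h1 hc)) => [h|[|h]] //.
  by case: (E c b hc _ h).
by case: (E b c hb he h).
Qed.

End Enumerate.
#[export] Hint Resolve dt_pow_enum_step dt_pow_enum dt_pow_type : def.

(** * Bijections and cardinality *)

Section Functions.
Variable M : zfc.
Implicit Types (x y z a b c d f g : M).

Lemma lam_function (F : M -> M) a b : pfun F -> (forall x, x ∈ a -> F x ∈ b) ->
  is_function (lam a F) a b.
Proof.
move=> hF h; split=> [p /(in_lam _ _ hF) [x [hx ->]]|x hx].
  by exists x, (F x); rewrite opairE; split=> //; split=> //; apply: h.
exists (F x); split; first by apply/relatedE/op_in_lam.
by move=> y /relatedE /op_in_lam h'; have [] := h' hF.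
Qed.

Lemma lam_bijection (F : M -> M) a b : pfun F -> (forall x, x ∈ a -> F x ∈ b) ->
  (forall x y, x ∈ a -> y ∈ a -> F x = F y -> x = y) ->
  (forall y, y ∈ b -> exists x, x ∈ a /\ y = F x) -> is_bijection (lam a F) a b.
Proof.
move=> hF h hi hs; split; first split; first exact: lam_function.
  move=> x x' y /relatedE /op_in_lam h1 /relatedE /op_in_lam h2.
  by have [hx e1] := h1 hF; have [hx' e2] := h2 hF; apply: hi => //; rewrite -e1.
by move=> y /hs [x [hx ->]]; exists x; apply/relatedE/op_in_lam.
Qed.

Lemma function_ap f a b x : is_function f a b -> x ∈ a ->
  ap f x ∈ b /\ forall y, related f x y <-> y = ap f x.
Proof.
move=> [hr hf] hx; have [y [hy hu]] := hf x hx.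
have e : ap f x = y.
  by apply: the_eq; [apply/relatedE|move=> z hz; symmetry; apply: hu; apply/relatedE].
split; last by move=> z; rewrite e; split=> [/hu|->].
have /hr [x' [y' [_ [hy' /opairE /op_inj [_ e']]]]] : op x y ∈ f by apply/relatedE.
by rewrite e e'.
Qed.

(* Schroeder-Bernstein for [d] included in [K]: on the least set containing
   [K \ d] and closed under [F] the bijection is [F], elsewhere the identity. *)
Lemma cardinal_no_injection K d (F : M -> M) : cardinal K -> d ∈ K -> pfun F ->
  (forall x, x ∈ K -> F x ∈ d) -> (forall x y, x ∈ K -> y ∈ K -> F x = F y -> x = y) -> False.
Proof.
move=> [hK hcard] hd hF hFd hFi.
have hdK := ord_mem hK hd.
have hF' i : dt (@any M) (fun e => F (e i)) by apply: (dt1 (F := F)); def.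
pose good Z := (forall y, y ∈ K -> ~ y ∈ d -> y ∈ Z) /\ forall y, y ∈ Z -> F y ∈ Z.
have hgood i : dfn (@any M) (fun e => good (e i)) by rewrite /good; def.
pose C := cpr (fun x => x ∈ K /\ forall Z, subset Z K -> good Z -> x ∈ Z).
have inC x : x ∈ C <-> x ∈ K /\ forall Z, subset Z K -> good Z -> x ∈ Z.
  by apply: (in_sep (P := fun x => forall Z, subset Z K -> good Z -> x ∈ Z)); def.
have Cgood : good C.
  split=> [y hy hyd|y /inC [hy h]]; apply/inC; split=> //.
  by move=> Z hZ [h _]; apply: h.
  by apply: hdK; apply: hFd.
  by move=> Z hZ hg; apply: (proj2 hg); apply: h.
pose H x := ite (x ∈ C) (F x) x.
have hH : pfun H by rewrite /H; def.
have HC x : x ∈ C -> H x = F x by move=> h; rewrite /H in_iteT.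
have HN x : ~ x ∈ C -> H x = x by move=> h; rewrite /H in_iteF.
have Hd x : x ∈ K -> H x ∈ d.
  move=> hx; case: (classic (x ∈ C)) => hxC; first by rewrite HC //; apply: hFd.
  by rewrite HN //; apply: NNPP => h; apply: hxC; apply: (proj1 Cgood).
have Hi x y : x ∈ K -> y ∈ K -> H x = H y -> x = y.
  have E u v : u ∈ C -> ~ v ∈ C -> H u <> H v.
    by move=> hu hv; rewrite HC // HN // => e; apply: hv; rewrite -e; apply: (proj2 Cgood).
  move=> hx hy; case: (classic (x ∈ C)) => hxC; case: (classic (y ∈ C)) => hyC.
  by rewrite !HC //; apply: hFi.
  by move/(E _ _ hxC hyC).
  by move=> e; case: (E y x hyC hxC).
  by rewrite !HN.
have Hs y : y ∈ d -> exists x, x ∈ K /\ y = H x.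
  move=> hy; case: (classic (y ∈ C)) => hyC; last first.
    by exists y; rewrite HN //; split=> //; apply: hdK.
  apply: NNPP => hn; have hyC' := hyC; move/inC: hyC' => [_ h].
  (* If [y] were not a value of [F] on [C], removing it would leave a smaller set with the closure
     properties of [C]. *)
  pose Z := cpr (fun x => x ∈ C /\ x <> y).
  have inZ x : x ∈ Z <-> x ∈ C /\ x <> y by apply: (in_sep (P := fun x => x <> y)); def.
  have /inZ [_ []] // : y ∈ Z.
  apply: h; first by move=> z /inZ [/inC []].
  split=> [z hz hzd|z /inZ [hz hzy]]; apply/inZ; split.
  exact: (proj1 Cgood).
  by move=> e; apply: hzd; rewrite e.
  exact: (proj2 Cgood).
  move=> e; apply: hn; exists z; rewrite HC //; split=> //; by case/inC: hz.
(* [cardinal] excludes bijections from [d] onto [K], so the bijection [H] has to be inverted. *)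
pose G y := the (fun x => x ∈ K /\ y = H x).
have hG : pfun G.
  apply: (dt_the (P := fun x e => x ∈ K /\ e 0 = H x)).
  by apply: dfn_and; [|apply: dfn_eq; [|apply: (dt1 (F := H))]]; def.
have Gs y : y ∈ d -> G y ∈ K /\ y = H (G y).
  move=> /Hs h; apply: (@the_spec M (fun x => x ∈ K /\ y = H x)) => //.
  by move=> u v [hu e1] [hv e2]; apply: Hi => //; rewrite -e1.
apply: (hcard d hd); exists (lam d G); apply: lam_bijection => //.
- by move=> y /Gs [].
- by move=> x y /Gs [_ e1] /Gs [_ e2] e; rewrite e1 e.
- move=> x hx; exists (H x); split; first exact: Hd.
  by have [h1 h2] := Gs (H x) (Hd x hx); apply: Hi.
Qed.

End Functions.

(** * The well-ordering of the power set *)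

Section Main.
Variables (M : zfc) (K L : M).
Implicit Types (x y z a b c d f g A B : M).

(** The family of codes is moved along [pow_enum] to a subset of theta, because the given
    well-orderings concern power sets of ordinals below [K]. *)
Definition code_set A : M := cpr (fun b => b ∈ pow_type L /\ code K L A (pow_enum L b)).
Definition less A B : Prop := trace_rank K A ∈ trace_rank K B \/
  trace_rank K A = trace_rank K B /\ op (code_set A) (code_set B) ∈ canon_wo (pow_type L).
Definition pow_order_pair p : Prop := exists A B, A ∈ pw K /\ B ∈ pw K /\ p = op A B /\ less A B.
Definition pow_order : M := cpr pow_order_pair.

Lemma dt_code_set C t : C K -> C L -> dt C t -> dt C (fun e => code_set (t e)).
Proof. by move=> hK hL; apply: dt1; rewrite /code_set; def. Qed.
#[local] Hint Resolve dt_code_set : def.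
Lemma dfn_less C t s : C K -> C L -> dt C t -> dt C s -> dfn C (fun e => less (t e) (s e)).
Proof. by move=> hK hL; apply: dfn2; rewrite /less; def. Qed.
#[local] Hint Resolve dfn_less : def.
Lemma dfn_pow_order_pair C : C K -> C L -> dfn C (fun e => pow_order_pair (e 0)).
Proof. by move=> hK hL; rewrite /pow_order_pair; def. Qed.

Lemma in_pow_order p : p ∈ pow_order <-> pow_order_pair p.
Proof.
apply: in_cpr; apply: (small_sub (a := prod (pw K) (pw K))); first exact: dfn_pow_order_pair.
by move=> z [A [B [hA [hB [-> _]]]]]; apply/in_prod; exists A, B.
Qed.

Lemma op_in_pow_order A B : op A B ∈ pow_order <-> A ∈ pw K /\ B ∈ pw K /\ less A B.
Proof.
rewrite in_pow_order; split=> [[A' [B' [hA [hB [/op_inj [-> ->]] h]]]]|[hA [hB h]]] //.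
by exists A, B.
Qed.

Hypothesis Kord : ordinal K.
Hypothesis Lord : ordinal L.
Hypothesis Lom : omega ∈ L.
Hypothesis Klim : forall a, a ∈ K -> succ a ∈ K.
Hypothesis Kne : exists a, a ∈ K.
Hypothesis Kcof : forall i F, i ∈ L -> pfun F -> (forall j, j ∈ i -> F j ∈ K) ->
  exists c, c ∈ K /\ forall j, j ∈ i -> F j ∈ c.
Hypothesis Kwo : forall a, a ∈ K -> is_well_ordering (canon_wo a) (pw a).
Hypothesis CMex : exists g, cofinal_in K L g.
Hypothesis LK : L ∈ K.
Hypothesis thetaK : pow_type L ∈ K.

Lemma in_code_set A b : b ∈ code_set A <-> b ∈ pow_type L /\ code K L A (pow_enum L b).
Proof. by apply: (in_sep (P := fun b => code K L A (pow_enum L b))); def. Qed.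

Lemma code_set_pw A : code_set A ∈ pw (pow_type L).
Proof. by apply/in_pw => b /in_code_set []. Qed.

(** As [pow_enum] reaches every subset of [L], equal code sets give equal families of codes, hence
    equal ideals, and the rank and the ideal determine the set. *)
Lemma trace_rank_code_set_injective A B : A ∈ pw K -> B ∈ pw K ->
  trace_rank K A = trace_rank K B -> code_set A = code_set B -> A = B.
Proof.
move=> /in_pw hA /in_pw hB hrk hZ.
have Kom := Kcof_omega Lom Kcof.
have [_ [hsurj [_ _]]] := pow_type_spec (Kwo LK).
have hcode Y : subset Y L -> code K L A Y <-> code K L B Y.
  move=> /in_pw /hsurj [b [hb ->]].
  have E C : code K L C (pow_enum L b) <-> b ∈ code_set C by rewrite in_code_set; tauto.
  by rewrite !E hZ.
apply: (invariants_injective Kord Klim Kne Kom Kwo hA hB hrk) => a ha.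
have hcode' Y : subset Y L -> code K L B Y <-> code K L A Y by move/hcode; tauto.
by split; apply: (code_determines Kord Lord Lom Klim Kne Kcof Kwo CMex).
Qed.

Lemma pow_order_wo : is_well_ordering pow_order (pw K).
Proof.
have Kom := Kcof_omega Lom Kcof.
have hrk A : A ∈ pw K -> ordinal (trace_rank K A).
  by move/in_pw => hA; case: (trace_rank_spec Kord Klim Kne Kom Kwo hA).
have hwo := Kwo thetaK.
apply: wo_intro.
- move=> p /in_pow_order [A [B [hA [hB [-> _]]]]]; by exists A, B.
- by move=> A hA /op_in_pow_order [_ [_ [/mem_irrefl|[_ /(wo_irr hwo)]]]].
- move=> A B C hA hB hC /op_in_pow_order [_ [_ h1]] /op_in_pow_order [_ [_ h2]]; apply/op_in_pow_order.
  split=> //; split=> //; case: h1 h2 => [h1|[e1 h1]] [h2|[e2 h2]].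
  + by left; apply: ord_trans h2 h1; apply: hrk.
  + by left; rewrite -e2.
  + by left; rewrite e1.
  + by right; split; [rewrite e1|apply: (wo_trans hwo h1 h2)].
- move=> A B hA hB; rewrite !op_in_pow_order.
  case: (ord_tri (hrk A hA) (hrk B hB)) => [h|[e|h]].
  + by left; split=> //; split=> //; left.
  + case: (wo_total hwo (code_set_pw A) (code_set_pw B)) => [h|[h|h]].
    * by left; split=> //; split=> //; right.
    * by right; left; apply: trace_rank_code_set_injective.
    * by right; right; split=> //; split=> //; right.
  + by right; right; split=> //; split=> //; left.
- move=> b hb [A0 hA0].
  have hbK A : A ∈ b -> A ∈ pw K by apply: hb.
  (* The least element of [b] is found by first minimizing the rank and then the code set among the
     members of that rank. *)
  have [||r [hr [[A1 [hA1 e1]] hmin]]] := @ord_least M (fun r => exists A, A ∈ b /\ r = trace_rank K A).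
      by def.
    by exists (trace_rank K A0); split; [apply/hrk/hbK|exists A0].
  pose D := cpr (fun z => z ∈ pw (pow_type L) /\ exists A, A ∈ b /\ r = trace_rank K A /\ z = code_set A).
  have inD z : z ∈ D <-> z ∈ pw (pow_type L) /\ exists A, A ∈ b /\ r = trace_rank K A /\ z = code_set A.
    by apply: (in_sep (P := fun z => exists A, A ∈ b /\ r = trace_rank K A /\ z = code_set A)); def.
  have [||m [/inD [_ [A [hA [eA ->]]]] hm]] := wo_min hwo (b := D).
      by move=> z /inD [].
    by exists (code_set A1); apply/inD; split; [apply: code_set_pw|exists A1].
  exists A; split=> // B hB.
  case: (ord_tri (hrk A (hbK A hA)) (hrk B (hbK B hB))) => [h|[e|h]].
  + by right; apply/op_in_pow_order; split; [apply: hbK|split; [apply: hbK|left]].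
  + have /hm [h|h] : code_set B ∈ D.
      by apply/inD; split; [apply: code_set_pw|exists B; rewrite eA].
    * by left; apply: trace_rank_code_set_injective => //; apply: hbK.
    * by right; apply/op_in_pow_order; split; [apply: hbK|split; [apply: hbK|right]].
  + by case: (hmin (trace_rank K B)); [rewrite eA|exists B].
Qed.

(** The defining formula uses only the ordinals [K] and [L]: cofinal maps are quantified in [code],
    and the well-orderings below [K] are the canonical ones. *)
Lemma pow_order_OD : OD pow_order.
Proof. apply: (OD_definable (P := pow_order_pair)); [exact: dfn_pow_order_pair|exact: in_pow_order]. Qed.

End Main.

(** * Consequences of the assumptions on the cofinality and on theta *)

Section Cofinality.
Variable M : zfc.
Implicit Types (x y z a b c d f g : M).

Lemma cof_unique k l l' : is_cof k l -> is_cof k l' -> l = l' :> M.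
Proof.
move=> [h1 [h2 h3]] [h1' [h2' h3']].
by case: (ord_tri h1 h1') => [h|[|h]] //; [case: (h3' l h)|case: (h3 l' h)].
Qed.

Lemma omega_lt_omega1 (o : M) : is_omega1 o -> omega ∈ o.
Proof.
move=> [ho [hnc _]]; case: (ord_le_total ho (ord_omega M)) => // h.
case: hnc; exists omega, (lam o (fun x => x)); split; first exact/is_omegaE.
split; first by apply: lam_function; def.
move=> x x' y /relatedE /op_in_lam h1 /relatedE /op_in_lam h2.
have hp : pfun (fun x : M => x) by def.
by have [_ <-] := h1 hp; have [_ <-] := h2 hp.
Qed.

(** An unbounded [F] on [i] would be a cofinal map from an ordinal smaller than the cofinality. *)
Lemma cof_bounded k l : ordinal k -> is_cof k l -> forall i F, i ∈ l -> pfun F ->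
  (forall j, j ∈ i -> F j ∈ k) -> exists c, c ∈ k /\ forall j, j ∈ i -> F j ∈ c.
Proof.
move=> hk [hl [_ hmin]] i F hi hF hFk; apply: NNPP => hn.
apply: (hmin i hi); exists (lam i F); split; first exact: lam_function.
move=> a ha; apply: NNPP => h; apply: hn; exists a; split=> // j hj.
have hFj := ord_in hk (hFk j hj); have hao := ord_in hk ha.
case: (ord_tri hFj hao) => [|[e|h']] //; case: h; exists j, (F j);
  (split=> //; split; first by apply/relatedE/op_in_lam).
  by right.
by left.
Qed.

Lemma cof_cofinal_in k l : ordinal k -> is_cof k l -> exists g, cofinal_in k l g.
Proof.
move=> hk [hl [[f [hf hc]] _]]; exists f; split.
  by move=> i /(function_ap hf) [].
move=> a ha; have [x [y [hx [hxy hay]]]] := hc a ha; exists x; split=> //.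
have [h1 h2] := function_ap hf hx; move/h2: hxy hay => -> hay.
by apply/ord_subE => //; [exact: ord_in ha|exact: ord_in h1].
Qed.

End Cofinality.

(** If theta were at least [K], following [pow_enum] by the bijection from the power set of [L] to
    [mu] would inject [K] into the smaller ordinal [mu]. *)
Lemma pow_type_lt (M : zfc) (K L mu : M) : cardinal K -> is_well_ordering (canon_wo L) (pw L) ->
  is_two_pow L mu -> mu ∈ K -> pow_type L ∈ K.
Proof.
move=> hK hwo [p [/powerE -> [_ [f [[hf hfi] _]]]]] hmu.
have [h1 [_ [h2 h3]]] := pow_type_spec hwo.
case: (ord_le_total (proj1 hK) h1) => // hs.
have hF x : x ∈ K -> ap f (pow_enum L x) ∈ mu /\ related f (pow_enum L x) (ap f (pow_enum L x)).
  by move=> /hs /h2 hx; have [h4 h5] := function_ap hf hx; split=> //; apply/h5.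
case: (@cardinal_no_injection M K mu (fun x => ap f (pow_enum L x)) hK hmu).
- by def.
- by move=> x /hF [].
- move=> x y hx hy e; have [_ hrx] := hF x hx; have [_ hry] := hF y hy.
  by apply: h3; [apply: hs|apply: hs|apply: (hfi _ _ (ap f (pow_enum L x))) => //; rewrite e].
Qed.

Theorem power_well_ordering (M : zfc) (kappa lambda omega1 mu : M) :
  singular_cardinal kappa -> is_cof kappa lambda -> is_omega1 omega1 ->
  ord_le omega1 lambda -> is_two_pow lambda mu -> mu ∈ kappa ->
  (forall alpha, alpha ∈ kappa ->
     exists p r, is_power alpha p /\ is_well_ordering r p /\ OD r) ->
  exists p r, is_power kappa p /\ is_well_ordering r p /\ OD r.
Proof.
move=> [hK [_ [l [hl hlk]]]] hlambda homega1 hcof hmu hmukappa hbelow.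
have Kord := proj1 hK; have Lord := proj1 hlambda.
have LK : lambda ∈ kappa by rewrite (cof_unique hlambda hl).
have Lom : omega ∈ lambda.
  have h := omega_lt_omega1 homega1.
  by case: hcof => [h'|<-] //; apply: (ord_trans Lord h').
have Kcof := cof_bounded Kord hlambda.
have Klim a : a ∈ kappa -> succ a ∈ kappa.
  (* Applied to a constant function on the ordinal 1, which is below the cofinality, [Kcof] gives a
     point of [kappa] above [a]. *)
  move=> ha; have h1 : succ emp ∈ lambda.
    by apply: (ord_trans Lord Lom); apply/omega_succ/omega_emp.
  have [||c [hc hac]] := Kcof (succ emp) (fun _ => a) h1; first by def.
    by [].
  apply: (ord_le_mem Kord _ hc).
    by apply: succ_mem (hac emp (mem_succ _)); apply: ord_in hc.
  by apply: ord_succ; apply: ord_in ha.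
have Kne : exists a, a ∈ kappa by exists lambda.
have Kwo a : a ∈ kappa -> is_well_ordering (canon_wo a) (pw a).
  by move=> ha; apply: canon_wo_spec; apply: hbelow.
have CMex := cof_cofinal_in Kord hlambda.
have thetaK := pow_type_lt hK (Kwo _ LK) hmu hmukappa.
exists (pw kappa), (pow_order kappa lambda); split; first by move=> z; apply: in_pw.
split; first exact: (pow_order_wo Kord Lord Lom Klim Kne Kcof Kwo CMex LK thetaK).
exact: pow_order_OD.
Qed.

Theorem theorem1p3 (M : structure) (hM : ZFC M)
  (kappa lambda omega1 mu : M)
  (hkappa : singular_cardinal kappa)
  (hlambda : is_cof kappa lambda)
  (homega1 : is_omega1 omega1)
  (hcof : ord_le omega1 lambda)
  (hmu : is_two_pow lambda mu)
  (hmukappa : mu ∈ kappa)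
  (hbelow : forall alpha : M, alpha ∈ kappa ->
     exists p r : M, is_power alpha p /\ is_well_ordering r p /\ OD r) :
  exists p r : M, is_power kappa p /\ is_well_ordering r p /\ OD r.
Proof.
exact: (@power_well_ordering (Zfc hM) kappa lambda omega1 mu).
Qed.
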